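(* Let $P_S>0$, $P_J\geq 0$, $\sigma^2=P_N>0$, and let $M\geq 2$ be a power of $2$. Consider the channel $R=S+e^{j\Theta}J+N$, where $S$ and $J$ are complex random variables with distributions $F_S$ and $F_J$ respectively, $\Theta$ is uniformly distributed on $\{2\pi i/M: i=0,\dots,M-1\}$, $N\sim\mathcal{CN}(0,P_N)$, and $S,J,\Theta,N$ are mutually independent. Write $\phi(F_S,F_J)=I(S;R)$ for the mutual information. Then $$\max_{F_S:\ \mathbb{E}|S|^2\le P_S}\ \min_{F_J:\ \mathbb{E}|J|^2\le P_J}\ \phi(F_S,F_J)=\log\Big(1+\frac{P_S}{P_J+P_N}\Big),$$ and the pair $(F_S^*,F_J^* )=(\mathcal{CN}(0,P_S),\mathcal{CN}(0,P_J))$ is a saddle point: for all $F_S$ with $\mathbb{E}|S|^2\le P_S$ and all $F_J$ with $\mathbb{E}|J|^2\le P_J$, $\phi(F_S,F_J^* )\le\phi(F_S^*,F_J^* )\le\phi(F_S^*,F_J)$, with $\phi(F_S^*,F_J^* )=\log(1+P_S/(P_J+P_N))$.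
   Context: $\mathcal{CN}(0,P)$ denotes the circularly symmetric complex Gaussian distribution with mean $0$ and variance $E|X|^2=P$. The logarithm is taken in a fixed base (base $2$ gives bits per symbol). *)

(* Defs.v *)
From HB Require Import structures.
From mathcomp Require Import all_boot all_order all_algebra.
From mathcomp Require Import all_classical all_reals all_analysis.
Set Implicit Arguments. Unset Strict Implicit. Unset Printing Implicit Defensive.
Import Order.TTheory GRing.Theory Num.Theory.
Import numFieldNormedType.Exports.
Local Open Scope classical_set_scope.
Local Open Scope ring_scope.

(* The complex plane C is modelled as R * R (real part, imaginary part),
   with the product sigma-algebra of the Borel sigma-algebras. *)
Definition CC (R : realType) := (R * R)%type.

Section Defs.
Variable R : realType.

Local Notation leb := (@lebesgue_measure R).

Definition csq (z : CC R) : R := z.1 ^+ 2 + z.2 ^+ 2.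

Definition cn_density (P : R) (z : CC R) : R :=
  expR (- csq z / P) / (pi * P).

Definition rot (M i : nat) (z : CC R) : CC R :=
  let t := 2 * pi * i%:R / M%:R in
  (z.1 * cos t - z.2 * sin t, z.1 * sin t + z.2 * cos t).

(* A probability measure mu on C is CN(0,P): for P = 0 it is the point mass
   at 0; for P > 0, mu has density cn_density P
   w.r.t. the two-dimensional Lebesgue measure (written as an iterated
   integral, equal by Tonelli to the product-measure integral). *)
Definition is_CN (P : R) (mu : probability (CC R) R) : Prop :=
  (P = 0 -> forall A : set (CC R), measurable A ->
     mu A = ((\1_A (0, 0) : R))%:E) /\
  (0 < P -> forall A : set (CC R), measurable A ->
    mu A = (\int[leb]_x \int[leb]_y
              ((\1_A (x, y) : R) * cn_density P (x, y))%:E)%E).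

Definition power_le (P : R) (mu : probability (CC R) R) : Prop :=
  (\int[mu]_z (csq z)%:E <= P%:E)%E.

(* Conditional density of R = s + e^{j Theta} J + N at r, given S = s,
   where J ~ FJ, Theta uniform on {2 pi i/M}, N ~ CN(0,PN), all independent. *)
Definition cond_density (M : nat) (PN : R) (FJ : probability (CC R) R)
    (s r : CC R) : R :=
  M%:R^-1 * \sum_(i < M)
    fine (\int[FJ]_j (cn_density PN
            (r.1 - s.1 - (rot M i j).1, r.2 - s.2 - (rot M i j).2))%:E).

Definition out_density (M : nat) (PN : R) (FS FJ : probability (CC R) R)
    (r : CC R) : R :=
  fine (\int[FS]_s (cond_density M PN FJ s r)%:E).

(* Pointwise integrand of the KL divergence D(p||q), in the nonnegative form
   p ln(p/q) - p + q (same integral as p ln(p/q) when p, q are densities). *)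
Definition kl_integrand (p q : R) : R := p * ln (p / q) - p + q.

Definition mutual_info (b : R) (M : nat) (PN : R)
    (FS FJ : probability (CC R) R) : \bar R :=
  ((\int[FS]_s \int[leb]_x \int[leb]_y
      (kl_integrand (cond_density M PN FJ s (x, y))
                    (out_density M PN FS FJ (x, y)))%:E)
   * ((ln b)^-1)%:E)%E.

End Defs.

(* Main.v *)
Require Import Defs.
From HB Require Import structures.
From mathcomp Require Import all_boot all_order all_algebra.
From mathcomp Require Import all_classical all_reals all_analysis.
From mathcomp Require Import measurable_realfun ring lra.
Import Order.TTheory GRing.Theory Num.Theory.
Import numFieldNormedType.Exports.
Local Open Scope classical_set_scope.
Local Open Scope ring_scope.

(* Let V = PJ + PN, W = PS + V, write p(r|s) for the conditional and q(r) for the output density, and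
   let w(s,r) = g_V(r - s) / g_W(r), where g_A is the CN(0,A) density.
   Upper bound (J Gaussian): the phases do not change CN(0,PJ), so p(r|s) = g_V(r - s); replacing q by
   g_W only increases the average divergence, and the average of D(g_V(. - s) || g_W) is
   ln (W / V) + (E|S|^2 + V) / W - 1.
   Lower bound (S Gaussian): p ln (p / q) - p >= p f - q e^f pointwise, used with f = ln w, which has
   E w(S, r) = 1 for every r. The mean of f only depends on the second moments of S and of the total
   noise, and equals ln (W / V) + PS (V - E|Z|^2) / (V W) with E|Z|^2 = E|J|^2 + PN <= V; this uses that
   S is centred, not that the noise is.
   All identities are arranged as equalities between sums of nonnegative integrands, so that Tonelli's
   theorem applies and no infinite quantity is subtracted. *)

Set Implicit Arguments.
Unset Strict Implicit.

(** * Integration against a measure given by a density *)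

(* The map [phi] is only ever the identity, between [R] and [measurableTypeR R] (or their squares), which
   carry the same measurable sets but non-convertible measurable structures. *)
Section integral_density.
Context d d' (T : measurableType d) (T' : measurableType d') (R : realType).
Variables (mu : {measure set T -> \bar R}) (nu : {measure set T' -> \bar R}).
Variables (phi : T' -> T) (g : T' -> R).
Hypothesis mphi : measurable_fun [set: T'] phi.
Hypotheses (mg : measurable_fun [set: T'] g) (g0 : forall x, 0 <= g x).
Hypothesis muE : forall A, measurable A ->
  mu A = (\int[nu]_x (\1_A (phi x) * g x)%:E)%E.
Import HBNNSimple.
Local Open Scope ereal_scope.

Let measurable_indic_phi (A : set T) : measurable A ->
  measurable_fun [set: T'] (fun x => (\1_A (phi x) : R)).
Proof. by move=> mA; apply: measurableT_comp mphi; exact: measurable_indic. Qed.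

(** A simple function is a finite combination of indicators of its level sets, and [muE] applies to
    each of them. *)
Let nnsfunE (h : {nnsfun T >-> R}) :
  \int[mu]_x (h x)%:E = \int[nu]_x (h (phi x) * g x)%:E.
Proof.
rewrite integralT_nnsfun sintegralE.
transitivity (\int[nu]_x
    \sum_(y \in range h) (y * (\1_(h @^-1` [set y]) (phi x) * g x))%:E); last first.
  apply: eq_integral => x _; rewrite fsumEFin//; congr EFin.
  rewrite [in RHS]fimfunE !fsbig_finite//= mulr_suml.
  by apply: eq_bigr => y _; rewrite mulrA.
rewrite ge0_integral_fsum//=; last 2 first.
- move=> r; apply/measurable_EFinP/measurable_funM => //.
  by apply/measurable_funM => //; exact: measurable_indic_phi.
- by move=> r x _; rewrite mulrA !EFinM mule_ge0 ?lee_fin//; exact: nnfun_muleindic_ge0.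
apply: eq_fsbigr => r /[!inE] -[x _ <-].
rewrite muE//.
under [RHS]eq_integral do rewrite EFinM.
rewrite ge0_integralZl_EFin//.
- by move=> y _; rewrite lee_fin mulr_ge0.
- by apply/measurable_EFinP/measurable_funM => //; exact: measurable_indic_phi.
Qed.

(** Monotone convergence along an increasing approximation of [f] by simple functions, used on both
    sides. *)
Lemma ge0_integral_density (f : T -> \bar R) : measurable_fun [set: T] f ->
  (forall x, 0 <= f x) -> \int[mu]_x f x = \int[nu]_x (f (phi x) * (g x)%:E).
Proof.
move=> mf f0; pose f_ := nnsfun_approx measurableT mf.
have f_cvg x : EFin \o f_^~ x @ \oo --> f x by exact: cvg_nnsfun_approx.
have f_nd x : {homo f_^~ x : m n / (m <= n)%N >-> (m <= n)%R}.
  by move=> m n mn; exact/lefP/nd_nnsfun_approx.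
transitivity (limn (fun n => \int[mu]_x (f_ n x)%:E)).
  rewrite -monotone_convergence//.
  - by apply: eq_integral => x _; apply/esym/cvg_lim => //; exact: f_cvg.
  - by move=> n; exact/measurable_EFinP.
  - by move=> n x _; rewrite lee_fin.
  - by move=> x _ m n mn; rewrite lee_fin f_nd.
under eq_fun do rewrite nnsfunE.
rewrite -monotone_convergence//.
- apply: eq_integral => x _; apply/cvg_lim => //.
  under eq_fun do rewrite EFinM.
  by apply: cvgeZr => //; exact: f_cvg.
- by move=> n; apply/measurable_EFinP/measurable_funM => //; exact: measurableT_comp.
- by move=> n x _; rewrite lee_fin mulr_ge0.
- by move=> x _ m n mn; rewrite lee_fin ler_wpM2r// f_nd.
Qed.

End integral_density.

(** * The real Gaussian *)

Section gaussian_line.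
Context {R : realType}.
Local Notation leb := (@lebesgue_measure R).

(** Serves to cancel the odd part of an integrand without integrating a signed function. *)
Lemma ge0_integral_reflect (f : R -> \bar R) : measurable_fun [set: R] f ->
  (forall x, 0 <= f x)%E -> (\int[leb]_x f x = \int[leb]_x f (- x)%R)%E.
Proof.
move=> mf f0.
rewrite -(@ge0_integral_pushforward _ _ (measurableTypeR R) (measurableTypeR R) R
  -%R _ leb setT f)//=.
by apply: eq_measure_integral => //= A mA _; exact/esym/lebesgue_measureN.
Qed.

Lemma ge0_integral_affine (G : R -> R) (a b : R) : 0 < a -> continuous G ->
  (forall x, 0 <= G x) ->
  (\int[leb]_x (G x)%:E = \int[leb]_x (G (a * x + b) * a)%:E)%E.
Proof.
(* The map [a * x + b], written as a shift followed by multiplication by a positive constant so that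
   its limits at both infinities are immediate. *)
move=> a0 cG G0; pose F (x : R^o) := (x + b / a) * a : R^o.
have dF (x : R) : is_derive (x : R^o) 1 F a.
  rewrite /F; apply: is_derive_eq.
  by rewrite scaler0 !addr0 add0r /GRing.scale/= mulr1.
have F'E : F^`()%classic = cst a.
  by apply/funext => x; rewrite derive1E (@derive_val _ _ _ _ _ _ _ (dF x)).
rewrite (@increasing_ge0_integration_by_substitutionT R F G)//.
- apply: eq_integral => x _; rewrite F'E !fctE /F.
  by rewrite mulrDl divfK ?gt_eqF// (mulrC x).
- by move=> x y xy; rewrite /F ltr_pM2r// ltrD2r.
- by rewrite F'E => x; exact: cvg_cst.
- by rewrite F'E; exact: is_cvg_cst.
- by rewrite F'E; exact: is_cvg_cst.
- by apply/gt0_cvgMlNy => //; exact: cvg_addrr_Ny.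
- by apply/gt0_cvgMly => //; exact: cvg_addrr.
Qed.

Let is_derive_gauss (x : R) :
  is_derive (x : R^o) 1 (@gauss_fun R : R^o -> R^o) (- (2 * x * gauss_fun x)).
Proof.
rewrite /gauss_fun; apply: is_derive_eq.
by rewrite /GRing.scale/= /GRing.scale/=; ring.
Qed.

Let continuous_expR1B : continuous (fun x : R => expR (1 - x)).
Proof.
move=> x; apply: (@continuous_comp _ _ _ (fun x : R => 1 - x) expR x).
  by apply: (@cvgB _ R^o); [exact: cvg_cst|exact: cvg_id].
exact: continuous_expR.
Qed.

Let cvg_expR1B : (expR (1 - x) : R) @[x --> +oo] --> (0 : R).
Proof.
have := cvgM (cvg_cst (expR 1 : R)) (@cvgr_expR R); rewrite mulr0.
move=> /(_ _ _); suff -> : (fun x : R => expR (1 - x)) =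
  ((fun=> expR 1) \* (fun x : R => expR (- x))) by apply.
by apply/funext => x; rewrite expRD.
Qed.

Let integral_expR1B :
  (\int[leb]_(x in `[0%R, +oo[) (expR (1 - x))%:E = (expR 1)%:E)%E.
Proof.
have dF (x : R) : is_derive (x : R^o) 1 (fun y : R^o => - expR (1 - y) : R^o)
    (expR (1 - x)).
  by apply: is_derive_eq; rewrite /GRing.scale/= /GRing.scale/=; ring.
have cF : continuous (fun y : R^o => - expR (1 - y) : R^o).
  by move=> x; apply/differentiable_continuous/derivable1_diffP; exact: ex_derive.
rewrite (@ge0_continuous_FTC2y R _ (fun x => - expR (1 - x)) 0 0)//.
- by rewrite subr0 sub0e -EFinN opprK.
- apply: continuous_subspaceT; exact: continuous_expR1B.
- by rewrite -oppr0; apply: cvgN; exact: cvg_expR1B.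
- by apply: cvg_at_right_filter; exact: cF.
- by move=> x _; rewrite derive1E (@derive_val _ _ _ _ _ _ _ (dF x)).
Qed.

(** Squeeze: [x <= expR x], and [x - x ^+ 2 <= - x] as soon as [2 <= x]. *)
Let cvg_XgaussD : (x * gauss_fun x : R) @[x --> +oo] --> (0 : R).
Proof.
apply: (@squeeze_cvgr _ _ _ _ (cst 0) (fun x => expR (- x))).
- near=> x; have x2 : 2 <= x by near: x; apply: nbhs_pinfty_ge; rewrite num_real.
  have x0 : 0 <= x by lra.
  rewrite mulr_ge0 ?gauss_fun_ge0//=.
  rewrite (@le_trans _ _ (expR x * gauss_fun x))//.
    rewrite ler_wpM2r ?gauss_fun_ge0//.
    by rewrite (le_trans _ (expR_ge1Dx x))// lerDr.
  by rewrite /gauss_fun -expRD ler_expR; nra.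
- exact: cvg_cst.
- exact: cvgr_expR.
Unshelve. all: by end_near. Qed.

(** Integration by parts: [- (x * gauss_fun x)] has derivative [(2 * x ^+ 2 - 1) * gauss_fun x] and
    vanishes at 0 and at infinity, so on the half-line twice the second moment equals the integral
    of [gauss_fun]. *)
Lemma integral_sqr_gauss_fun :
  (\int[leb]_x (x ^+ 2 * gauss_fun x)%:E = (Num.sqrt pi / 2)%:E)%E.
Proof.
(* [expR (1 - x)] dominates [gauss_fun], which makes the derivative [f] of [G] nonnegative. *)
pose G (x : R) := - (x * gauss_fun x) - expR (1 - x).
pose f (x : R) := (2 * x ^+ 2 - 1) * gauss_fun x + expR (1 - x).
have dG (x : R) : is_derive (x : R^o) 1 (G : R^o -> R^o) (f x).
  rewrite /G; apply: is_derive_eq.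
  by rewrite /f /gauss_fun /GRing.scale/= /GRing.scale/=; ring.
have cG : continuous G.
  by move=> x; apply/differentiable_continuous/derivable1_diffP; exact: ex_derive.
have cg := @continuous_gauss_fun R.
have cX : continuous (fun x : R => x ^+ 2) by exact: sqr_continuous.
have cXg : continuous (fun x : R => x ^+ 2 * gauss_fun x).
  by move=> x; apply: cvgM; [exact: cX|exact: cg].
have f0 x : 0 <= f x.
  have : gauss_fun x <= expR (1 - x) by rewrite /gauss_fun ler_expR; nra.
  have := gauss_fun_ge0 x; rewrite /f; nra.
have intf : (\int[leb]_(x in `[0%R, +oo[) (f x)%:E = (expR 1)%:E)%E.
  rewrite (@ge0_continuous_FTC2y R f G 0 0)//.
  - by rewrite /G mul0r subr0 oppr0 sub0r sub0e -EFinN opprK.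
  - apply: continuous_subspaceT => x; apply: cvgD; last exact: continuous_expR1B.
    apply: cvgM; last exact: cg.
    by apply: cvgB; [apply: cvgM; [exact: cvg_cst|exact: cX]|exact: cvg_cst].
  - rewrite -[X in _ --> X](subr0 0) -{1}oppr0; apply: cvgB.
      by apply: cvgN; exact: cvg_XgaussD.
    exact: cvg_expR1B.
  - by apply: cvg_at_right_filter; exact: cG.
  - by move=> x _; rewrite derive1E (@derive_val _ _ _ _ _ _ _ (dG x)).
have mf (h : R -> R) : continuous h -> measurable_fun (`[0%R, +oo[%classic : set R) (EFin \o h).
  move=> ch; apply/measurable_EFinP/measurable_funTS. exact: continuous_measurable_fun.
rewrite ge0_symfun_integralT//=; last 2 first.
- by move=> x; rewrite mulr_ge0 ?sqr_ge0 ?gauss_fun_ge0.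
- by move=> x; rewrite /gauss_fun /= sqrrN.
rewrite (_ : [set x | _] = `[0, +oo[%classic); last first.
  by apply/seteqP; split => x/=; rewrite in_itv/= andbT.
(* The definition of [f] with its negative term moved across. The dominating exponential and [f]
   both integrate to [expR 1], which cancels. *)
have : (\int[leb]_(x in `[0%R, +oo[) (2 * (x ^+ 2 * gauss_fun x) + expR (1 - x))%:E
  = \int[leb]_(x in `[0%R, +oo[) (gauss_fun x + f x)%:E)%E.
  by apply: eq_integral => x _; congr EFin; rewrite /f; ring.
under eq_integral do rewrite EFinD.
under [in RHS]eq_integral do rewrite EFinD.
have X0 (x : R) : 0 <= x ^+ 2 * gauss_fun x.
  by rewrite mulr_ge0 ?sqr_ge0 ?gauss_fun_ge0.
have cf : continuous f.
  move=> x; apply: cvgD; last exact: continuous_expR1B.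
  apply: cvgM; last exact: cg.
  by apply: cvgB; [apply: cvgM; [exact: cvg_cst|exact: cX]|exact: cvg_cst].
rewrite ge0_integralD//=.
2: by move=> x _; rewrite lee_fin mulr_ge0.
2: by apply: mf => x; apply: cvgM; [exact: cvg_cst|exact: cXg].
2: exact: mf.
rewrite ge0_integralD//=.
2: by move=> x _; rewrite lee_fin gauss_fun_ge0.
2: exact: mf.
2: by move=> x _; rewrite lee_fin.
2: exact: mf.
rewrite integral_expR1B intf.
rewrite integral0y_gauss => /(congr1 (fun z => z - (expR 1)%:E)%E).
rewrite !addeK// => <-.
under [in RHS]eq_integral do rewrite EFinM.
rewrite [in RHS]ge0_integralZl//=.
- exact: mf.
- by move=> x _; rewrite lee_fin.
Qed.

(** The centred real Gaussian of variance [A / 2], that is, the law of one coordinate of CN(0,A). *)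
Definition gauss_pdf (A x : R) : R := expR (- x ^+ 2 / A) / Num.sqrt (pi * A).

Lemma gauss_pdf_ge0 A x : 0 <= gauss_pdf A x.
Proof. by rewrite divr_ge0 ?expR_ge0 ?sqrtr_ge0. Qed.

Lemma continuous_gauss_pdf A : continuous (gauss_pdf A).
Proof.
move=> x; apply: cvgM; last exact: cvg_cst.
apply: (@continuous_comp _ _ _ (fun x : R => - x ^+ 2 / A) expR x).
  apply: cvgM; last exact: cvg_cst.
  by apply: (@cvgN _ R^o); exact: sqr_continuous.
exact: continuous_expR.
Qed.

Lemma measurable_gauss_pdf A : measurable_fun [set: R] (gauss_pdf A).
Proof. by apply: continuous_measurable_fun; exact: continuous_gauss_pdf. Qed.

Lemma gauss_pdf_scale A u : 0 < A ->
  gauss_pdf A (Num.sqrt A * u) * Num.sqrt A = gauss_fun u / Num.sqrt pi.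
Proof.
move=> A0; rewrite /gauss_pdf /gauss_fun sqrtrM ?pi_ge0// exprMn sqr_sqrtr ?ltW//.
have sA : Num.sqrt A != 0 by rewrite gt_eqF// sqrtr_gt0.
have sp : Num.sqrt (pi : R) != 0 by rewrite gt_eqF// sqrtr_gt0 pi_gt0.
rewrite (_ : - (A * u ^+ 2) / A = - u ^+ 2); last by field; rewrite gt_eqF.
by field; rewrite sp sA.
Qed.

Lemma integral_gauss_pdf (A m : R) : 0 < A ->
  (\int[leb]_x (gauss_pdf A (x - m))%:E = 1)%E.
Proof.
move=> A0; rewrite (@ge0_integral_affine _ (Num.sqrt A) m) ?sqrtr_gt0//; last 2 first.
- move=> x; apply: (@continuous_comp _ _ _ (fun x : R => x - m) (gauss_pdf A) x).
    by apply: (@cvgB _ R^o); [exact: cvg_id|exact: cvg_cst].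
  exact: continuous_gauss_pdf.
- by move=> x; exact: gauss_pdf_ge0.
under eq_integral do rewrite addrK gauss_pdf_scale// mulrC EFinM.
rewrite ge0_integralZl//=; last 2 first.
- by apply/measurable_EFinP; exact: measurable_gauss_fun.
- by move=> x _; rewrite lee_fin gauss_fun_ge0.
by rewrite integralT_gauss -EFinM mulVf// gt_eqF// sqrtr_gt0 pi_gt0.
Qed.

(** By reflection the integrals for [a] and [- a] agree. In their sum the cross term [2 * a * b * x]
    disappears pointwise, so only nonnegative integrands are split. *)
Lemma integral_gauss_fun_affine_sqr (a b : R) :
  (\int[leb]_x (gauss_fun x * (a * x + b) ^+ 2)%:E =
   (Num.sqrt pi * (a ^+ 2 / 2 + b ^+ 2))%:E)%E.
Proof.
pose h (c x : R) := gauss_fun x * (c * x + b) ^+ 2.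
have h0 c x : (0 <= (h c x)%:E)%E.
  by rewrite lee_fin mulr_ge0 ?sqr_ge0 ?gauss_fun_ge0.
have mh c : measurable_fun [set: R] (EFin \o h c).
  apply/measurable_EFinP/measurable_funM; first exact: measurable_gauss_fun.
  by apply: measurable_funX; apply: measurable_funD => //; exact: measurable_funM.
have hN : (\int[leb]_x (h a x)%:E = \int[leb]_x (h (- a) x)%:E)%E.
  rewrite (@ge0_integral_reflect (EFin \o h a))//; last by move=> x; exact: h0.
  apply: eq_integral => x _ /=.
  by rewrite /h /gauss_fun sqrrN mulrN mulNr.
have hD : (\int[leb]_x (h a x)%:E + \int[leb]_x (h (- a) x)%:E =
    (Num.sqrt pi * (a ^+ 2 + 2 * b ^+ 2))%:E)%E.
  rewrite -ge0_integralD//; try by [move=> x _; exact: h0|exact: mh].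
  rewrite (_ : (fun x => _) = (fun x => (2 * a ^+ 2)%:E * (x ^+ 2 * gauss_fun x)%:E +
      (2 * b ^+ 2)%:E * (gauss_fun x)%:E)%E); last first.
    by apply/funext => x; rewrite -!EFinM -!EFinD; congr EFin; rewrite /h; ring.
  rewrite ge0_integralD//=.
  2: move=> x _; rewrite -EFinM lee_fin.
  2: by do ![exact: sqr_ge0|exact: gauss_fun_ge0|apply: mulr_ge0].
  2: apply/measurable_EFinP/measurable_funM => //.
  2: by apply: measurable_funM => //; exact: measurable_gauss_fun.
  2: move=> x _; rewrite -EFinM lee_fin.
  2: by do ![exact: sqr_ge0|exact: gauss_fun_ge0|apply: mulr_ge0].
  2: by apply/measurable_EFinP/measurable_funM => //; exact: measurable_gauss_fun.
  rewrite ge0_integralZl//=.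
  2: by apply/measurable_EFinP/measurable_funM => //; exact: measurable_gauss_fun.
  2: by move=> x _; rewrite lee_fin; do ![exact: sqr_ge0|exact: gauss_fun_ge0|apply: mulr_ge0].
  2: by rewrite lee_fin mulr_ge0// sqr_ge0.
  rewrite ge0_integralZl//=.
  2: by apply/measurable_EFinP; exact: measurable_gauss_fun.
  2: by move=> x _; rewrite lee_fin gauss_fun_ge0.
  2: by rewrite lee_fin mulr_ge0// sqr_ge0.
  rewrite integral_sqr_gauss_fun integralT_gauss -!EFinM -EFinD.
  by congr EFin; field.
(* Finiteness allows the doubled identity [hD] to be halved in the reals. *)
have : (\int[leb]_x (h a x)%:E \is a fin_num)%E.
  rewrite ge0_fin_numE ?integral_ge0//.
  have : (\int[leb]_x (h a x)%:E <= (Num.sqrt pi * (a ^+ 2 + 2 * b ^+ 2))%:E)%E.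
    rewrite -hD leeDl//; apply: integral_ge0 => x _; exact: h0.
  by move/le_lt_trans; apply; rewrite ltry.
move: hD; rewrite -hN; case: (\int[leb]_x (h a x)%:E)%E => // y.
rewrite -EFinD => -[yE] _; congr EFin; lra.
Qed.

Lemma integral_gauss_pdf_sqr (A m t : R) : 0 < A ->
  (\int[leb]_x (gauss_pdf A (x - m) * (x - t) ^+ 2)%:E = (A / 2 + (m - t) ^+ 2)%:E)%E.
Proof.
move=> A0; rewrite (@ge0_integral_affine _ (Num.sqrt A) m) ?sqrtr_gt0//; last 2 first.
- move=> x; apply: cvgM.
    apply: (@continuous_comp _ _ _ (fun x : R => x - m) (gauss_pdf A) x).
      by apply: (@cvgB _ R^o); [exact: cvg_id|exact: cvg_cst].
    exact: continuous_gauss_pdf.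
  apply: (@continuous_comp _ _ _ (fun x : R => x - t) (fun x => x ^+ 2) x).
    by apply: (@cvgB _ R^o); [exact: cvg_id|exact: cvg_cst].
  exact: sqr_continuous.
- by move=> x; rewrite mulr_ge0 ?sqr_ge0 ?gauss_pdf_ge0.
under eq_integral => x _.
  rewrite addrK mulrAC gauss_pdf_scale// -addrA (mulrAC _ _ (_ ^+ 2)) mulrC EFinM.
  over.
rewrite ge0_integralZl//=.
- rewrite integral_gauss_fun_affine_sqr -EFinM mulKf ?sqr_sqrtr ?(ltW A0)//.
  by rewrite gt_eqF// sqrtr_gt0 pi_gt0.
- apply/measurable_EFinP/measurable_funM; first exact: measurable_gauss_fun.
  by apply: measurable_funX; apply: measurable_funD => //; exact: measurable_funM.
- by move=> x _; rewrite lee_fin mulr_ge0 ?sqr_ge0 ?gauss_fun_ge0.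
Qed.

(* Completing the square: the product is a Gaussian in [x] centred at [z A / (A + B)]. *)
Lemma gauss_pdf_convolution (A B z : R) : 0 < A -> 0 < B ->
  (\int[leb]_x (gauss_pdf A x * gauss_pdf B (z - x))%:E = (gauss_pdf (A + B) z)%:E)%E.
Proof.
move=> A0 B0; have AB0 : 0 < A + B by rewrite addr_gt0.
have C0 : 0 < A * B / (A + B) by rewrite divr_gt0// mulr_gt0.
have E x : gauss_pdf A x * gauss_pdf B (z - x) =
  gauss_pdf (A + B) z * gauss_pdf (A * B / (A + B)) (x - z * A / (A + B)).
  rewrite /gauss_pdf !mulf_div -!expRD -!sqrtrM ?mulr_ge0 ?pi_ge0 ?(ltW A0)//; last first.
    by rewrite ltW.
  congr (expR _ / Num.sqrt _); field; rewrite ?gt_eqF//.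
under eq_integral do rewrite E EFinM.
rewrite ge0_integralZl//= ?integral_gauss_pdf ?mule1 ?lee_fin ?gauss_pdf_ge0//.
- apply/measurable_EFinP; apply: (measurableT_comp (measurable_gauss_pdf _)).
  exact: measurable_funB.
- by move=> x _; rewrite lee_fin gauss_pdf_ge0.
Qed.

End gaussian_line.

(** * The complex Gaussian *)

Section gaussian_plane.
Context {R : realType}.
Local Notation leb := (@lebesgue_measure R).
Local Notation leb2 := (leb \x leb)%E.
Implicit Types (z m t r : R * R).

Lemma integral_plane (f : R * R -> \bar R) : measurable_fun [set: R * R] f ->
  (forall z, 0 <= f z)%E ->
  (\int[leb]_x \int[leb]_y f (x, y) = \int[leb2]_z f z)%E.
Proof. by move=> mf f0; rewrite fubini_tonelli1. Qed.

Section parametric_integral.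
Context d (X : measurableType d) (f : X -> R * R -> \bar R).
Hypothesis mf : measurable_fun [set: X * (R * R)] (fun p => f p.1 p.2).
Hypothesis f0 : forall s z, (0 <= f s z)%E.

Let mfs s : measurable_fun [set: R * R] (f s).
Proof. exact: (measurableT_comp mf (pair1_measurable s)). Qed.

(** The first coordinate is regrouped with the parameter, so that Tonelli's theorem over one real
    variable can be applied twice. *)
Let g (p : (X * R) * R) := f p.1.1 (p.1.2, p.2).

Let mgF : measurable_fun [set: X * R] (fun p => \int[leb]_y g (p, y))%E.
Proof.
have mg : measurable_fun [set: (X * R) * R] g.
  have mp : measurable_fun setT (fun p : (X * R) * R => (p.1.1, (p.1.2, p.2))).
    apply/measurable_fun_pairP; split => /=.
      exact: (measurableT_comp measurable_fst measurable_fst).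
    apply/measurable_fun_pairP; split => /=; last exact: measurable_snd.
    exact: (measurableT_comp measurable_snd measurable_fst).
  exact: (measurableT_comp mf mp).
apply: (@measurable_fun_fubini_tonelli_F _ _ (X * R)%type (measurableTypeR R) R leb g) => //.
by move=> p; exact: f0.
Qed.

Let gF0 p : (0 <= \int[leb]_y g (p, y))%E.
Proof. by apply: integral_ge0 => y _; exact: f0. Qed.

Let plane_iterated s :
  (\int[leb2]_z f s z = \int[leb]_x \int[leb]_y g ((s, x), y))%E.
Proof. by rewrite -integral_plane. Qed.

Lemma measurable_integral_plane : measurable_fun [set: X] (fun s => \int[leb2]_z f s z)%E.
Proof.
rewrite (_ : (fun s => _) = fun s => (\int[leb]_x \int[leb]_y g ((s, x), y))%E).
  exact: (@measurable_fun_fubini_tonelli_F _ _ X (measurableTypeR R) R leb _ mgF gF0).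
by apply/funext => s; exact: plane_iterated.
Qed.

(** The average over the parameter is moved past the first coordinate, then, for each value of it,
    past the second. *)
Lemma tonelli_plane (mu : probability X R) :
  (\int[mu]_s \int[leb2]_z f s z = \int[leb2]_z \int[mu]_s f s z)%E.
Proof.
transitivity (\int[mu]_s \int[leb]_x \int[leb]_y g ((s, x), y))%E.
  by apply: eq_integral => s _; exact: plane_iterated.
rewrite (@fubini_tonelli _ _ X (measurableTypeR R) R mu leb
  (fun p => \int[leb]_y g (p, y))%E mgF gF0).
rewrite -integral_plane.
- apply: eq_integral => x _.
  apply: (@fubini_tonelli _ _ X (measurableTypeR R) R mu leb
    (fun p => g ((p.1, x), p.2))); last by move=> p; exact: f0.
  have mp : measurable_fun setT (fun p : X * R => (p.1, (x, p.2))).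
    apply/measurable_fun_pairP; split => /=; first exact: measurable_fst.
    by apply/measurable_fun_pairP; split; [exact: measurable_cst|exact: measurable_snd].
  exact: (measurableT_comp mf mp).
- exact: (@measurable_fun_fubini_tonelli_G _ _ _ _ R mu
    (fun p => f p.1 p.2) mf (fun p => f0 p.1 p.2)).
- by move=> z; exact: integral_ge0.
Qed.

End parametric_integral.

Lemma integral_plane_prod (f g : R -> R) :
  measurable_fun [set: R] f -> measurable_fun [set: R] g ->
  (forall x, 0 <= f x) -> (forall x, 0 <= g x) ->
  (\int[leb2]_z (f z.1 * g z.2)%:E =
   (\int[leb]_x (f x)%:E) * (\int[leb]_x (g x)%:E))%E.
Proof.
move=> mf mg f0 g0; rewrite -integral_plane.
2: by apply/measurable_EFinP/measurable_funM; exact: measurableT_comp.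
2: by move=> z; rewrite lee_fin mulr_ge0.
rewrite -ge0_integralZr//.
2: exact/measurable_EFinP.
2: by move=> x _; rewrite lee_fin.
2: by apply: integral_ge0 => x _; rewrite lee_fin.
apply: eq_integral => x _ /=; under eq_integral do rewrite EFinM.
rewrite ge0_integralZl//.
- exact/measurable_EFinP.
- by move=> y _; rewrite lee_fin.
- by rewrite lee_fin.
Qed.

Lemma csq_ge0 (z : CC R) : 0 <= csq z.
Proof. by rewrite addr_ge0// sqr_ge0. Qed.

Lemma cn_density_ge0 (A : R) z : 0 < A -> 0 <= cn_density A z.
Proof. by move=> A0; rewrite divr_ge0 ?expR_ge0// mulr_ge0 ?pi_ge0// ltW. Qed.

Lemma cn_density_gt0 (A : R) z : 0 < A -> 0 < cn_density A z.
Proof. by move=> A0; rewrite divr_gt0 ?expR_gt0// mulr_gt0 ?pi_gt0. Qed.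

(** The bound is the peak at the origin; being uniform, it makes every average of such densities
    finite. *)
Lemma cn_density_ub (A : R) z : 0 < A -> cn_density A z <= (pi * A)^-1.
Proof.
move=> A0; rewrite /cn_density ler_piMl ?invr_ge0 ?mulr_ge0 ?pi_ge0 ?(ltW A0)//.
by rewrite -expR0 ler_expR mulNr oppr_le0 divr_ge0 ?csq_ge0 ?(ltW A0).
Qed.

Lemma cn_densityE (A : R) z : 0 < A ->
  cn_density A z = gauss_pdf A z.1 * gauss_pdf A z.2.
Proof.
move=> A0; rewrite /cn_density /gauss_pdf mulf_div -expRD -expr2 sqr_sqrtr.
  by congr (expR _ / _); rewrite /csq -mulrDl opprD.
by rewrite mulr_ge0 ?pi_ge0 ?ltW.
Qed.

Section measurability.
Context d (X : measurableType d).
Implicit Types u v : X -> R * R.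

Lemma measurable_funB2 u v : measurable_fun [set: X] u ->
  measurable_fun [set: X] v -> measurable_fun [set: X] (fun x => u x - v x).
Proof.
move=> mu mv; apply/measurable_fun_pairP; split.
  apply: measurable_funB; exact: measurableT_comp.
apply: measurable_funB; exact: measurableT_comp.
Qed.

Lemma measurable_csq u : measurable_fun [set: X] u ->
  measurable_fun [set: X] (fun x => csq (u x)).
Proof.
move=> mu; apply: measurable_funD; apply: measurable_funX; exact: measurableT_comp.
Qed.

Lemma measurable_cn_density (A : R) u : measurable_fun [set: X] u ->
  measurable_fun [set: X] (fun x => cn_density A (u x)).
Proof.
move=> mu; apply: measurable_funM => //; apply: measurableT_comp => //.
by apply: measurable_funM => //; apply: measurableT_comp => //; exact: measurable_csq.
Qed.

Lemma measurable_rot (M i : nat) u : measurable_fun [set: X] u ->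
  measurable_fun [set: X] (fun x => Defs.rot M i (u x)).
Proof.
move=> mu; apply/measurable_fun_pairP; split => /=.
  by apply: measurable_funB; apply: measurable_funM => //; exact: measurableT_comp.
by apply: measurable_funD; apply: measurable_funM => //; exact: measurableT_comp.
Qed.

End measurability.

Let measurable_gauss_pdfB A (a : R) : measurable_fun [set: R] (fun x => gauss_pdf A (x - a)).
Proof.
by apply: (measurableT_comp (measurable_gauss_pdf A)); exact: measurable_funB.
Qed.

Lemma integral_cn_density (A : R) m : 0 < A ->
  (\int[leb2]_r (cn_density A (r - m))%:E = 1)%E.
Proof.
move=> A0; under eq_integral do rewrite cn_densityE//=.
rewrite (@integral_plane_prod (fun x => gauss_pdf A (x - m.1))
  (fun x => gauss_pdf A (x - m.2)))// ?integral_gauss_pdf ?mule1// => x.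
all: exact: gauss_pdf_ge0.
Qed.

(** Variance plus squared bias: each coordinate contributes [A / 2] and the square of its own
    offset, while the other coordinate integrates to 1. *)
Lemma integral_cn_density_csq (A : R) m t : 0 < A ->
  (\int[leb2]_r (cn_density A (r - m) * csq (r - t))%:E = (A + csq (m - t))%:E)%E.
Proof.
move=> A0.
have mS (a b : R) :
    measurable_fun [set: R] (fun x => gauss_pdf A (x - a) * (x - b) ^+ 2).
  by apply: measurable_funM => //; apply: measurable_funX; exact: measurable_funB.
have S0 (a b x : R) : 0 <= gauss_pdf A (x - a) * (x - b) ^+ 2.
  by rewrite mulr_ge0 ?sqr_ge0 ?gauss_pdf_ge0.
have g0 (a x : R) : 0 <= gauss_pdf A (x - a) by exact: gauss_pdf_ge0.
under eq_integral => r _.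
  rewrite (_ : _ * _ = (gauss_pdf A (r.1 - m.1) * (r.1 - t.1) ^+ 2) * gauss_pdf A (r.2 - m.2)
    + gauss_pdf A (r.1 - m.1) * (gauss_pdf A (r.2 - m.2) * (r.2 - t.2) ^+ 2)); last first.
    by rewrite cn_densityE// /csq/=; ring.
  rewrite EFinD; over.
rewrite ge0_integralD//=.
2: by move=> r _; rewrite lee_fin mulr_ge0.
2: apply/measurable_EFinP/measurable_funM.
2: exact: (measurableT_comp (mS _ _)).
2: exact: (measurableT_comp (measurable_gauss_pdfB _ _)).
2: by move=> r _; rewrite lee_fin mulr_ge0.
2: apply/measurable_EFinP/measurable_funM.
2: exact: (measurableT_comp (measurable_gauss_pdfB _ _)).
2: exact: (measurableT_comp (mS _ _)).
rewrite (@integral_plane_prod (fun x => gauss_pdf A (x - m.1) * (x - t.1) ^+ 2)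
  (fun x => gauss_pdf A (x - m.2)))//.
rewrite (@integral_plane_prod (fun x => gauss_pdf A (x - m.1))
  (fun x => gauss_pdf A (x - m.2) * (x - t.2) ^+ 2))//.
rewrite !integral_gauss_pdf// !integral_gauss_pdf_sqr// mule1 mul1e -EFinD.
by congr EFin; rewrite /csq/=; field.
Qed.

Lemma cn_density_convolution (A B : R) r : 0 < A -> 0 < B ->
  (\int[leb2]_s (cn_density A s * cn_density B (r - s))%:E =
   (cn_density (A + B) r)%:E)%E.
Proof.
move=> A0 B0.
have mS (a : R) :
    measurable_fun [set: R] (fun x => gauss_pdf A x * gauss_pdf B (a - x)).
  apply: measurable_funM; first exact: measurable_gauss_pdf.
  by apply: (measurableT_comp (measurable_gauss_pdf B)); exact: measurable_funB.
under eq_integral do rewrite !cn_densityE// mulrACA/=.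
rewrite (@integral_plane_prod (fun x => gauss_pdf A x * gauss_pdf B (r.1 - x))
  (fun x => gauss_pdf A x * gauss_pdf B (r.2 - x)))//.
2: by move=> x; rewrite mulr_ge0 ?gauss_pdf_ge0.
2: by move=> x; rewrite mulr_ge0 ?gauss_pdf_ge0.
by rewrite !gauss_pdf_convolution// -EFinM -cn_densityE// addr_gt0.
Qed.

Let measurable_idfun_plane : measurable_fun
  [set: measurableTypeR R * measurableTypeR R]
  (idfun : measurableTypeR R * measurableTypeR R -> R * R).
Proof. by move=> _ A mA; rewrite setTI. Qed.

Lemma ge0_integral_CN (P : R) (mu : probability (CC R) R) (f : R * R -> \bar R) :
  0 < P -> is_CN P mu -> measurable_fun [set: R * R] f -> (forall z, 0 <= f z)%E ->
  (\int[mu]_z f z = \int[leb2]_z (f z * (cn_density P z)%:E))%E.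
Proof.
move=> P0 [_ /(_ P0) muE] mf f0.
have mcn : measurable_fun [set: R * R] (fun z => cn_density P z).
  by apply: measurable_cn_density; exact: measurable_id.
apply: (@ge0_integral_density _ _ (R * R)%type
  (measurableTypeR R * measurableTypeR R)%type R mu (leb \x leb)%E idfun
  (fun z => cn_density P z)) => //.
  by move=> z; exact: cn_density_ge0.
move=> A mA; rewrite -integral_plane; first exact: (muE A mA).
- by apply/measurable_EFinP/measurable_funM => //; exact: measurable_indic.
- by move=> z; rewrite lee_fin mulr_ge0// cn_density_ge0.
Qed.

Lemma ge0_integral_CN0 (mu : probability (CC R) R) (f : R * R -> \bar R) :
  is_CN 0 mu -> measurable_fun [set: R * R] f -> (forall z, 0 <= f z)%E ->
  (\int[mu]_z f z = f 0%R)%E.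
Proof.
move=> [/(_ erefl) muE _] mf f0.
rewrite (@eq_measure_integral _ _ _ setT (\d_(0 : R * R))).
  by rewrite integral_dirac// diracT mul1e.
by move=> A mA _; exact: (muE A mA).
Qed.

Lemma integral_CN_csq (P : R) (mu : probability (CC R) R) (w : R * R) :
  0 <= P -> is_CN P mu -> (\int[mu]_z (csq (z - w))%:E = (P + csq w)%:E)%E.
Proof.
rewrite le_eqVlt => /predU1P[<-|P0] CNmu.
  rewrite ge0_integral_CN0//.
  - by congr EFin; rewrite /csq/=; ring.
  - by apply/measurable_EFinP/measurable_csq; exact: measurable_funB2.
  - by move=> z; rewrite lee_fin csq_ge0.
rewrite (ge0_integral_CN P0 CNmu).
- under eq_integral => z _ do rewrite -EFinM mulrC -[in cn_density _ z](subr0 z).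
  by rewrite integral_cn_density_csq//; congr EFin; rewrite /csq/=; ring.
- by apply/measurable_EFinP/measurable_csq; exact: measurable_funB2.
- by move=> z; rewrite lee_fin csq_ge0.
Qed.

(** For [0 < P] this is the convolution of two Gaussians; for [P = 0] the point mass returns the
    second factor unchanged. *)
Lemma integral_CN_cn_density (P B : R) (mu : probability (CC R) R) r :
  0 <= P -> 0 < B -> is_CN P mu ->
  (\int[mu]_z (cn_density B (r - z))%:E = (cn_density (P + B) r)%:E)%E.
Proof.
rewrite le_eqVlt => /predU1P[<-|P0] B0 CNmu.
  rewrite ge0_integral_CN0// ?add0r ?subr0//.
  - by apply/measurable_EFinP/measurable_cn_density; exact: measurable_funB2.
  - by move=> z; rewrite lee_fin cn_density_ge0.
rewrite (ge0_integral_CN P0 CNmu).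
- by under eq_integral do rewrite -EFinM mulrC; exact: cn_density_convolution.
- by apply/measurable_EFinP/measurable_cn_density; exact: measurable_funB2.
- by move=> z; rewrite lee_fin cn_density_ge0.
Qed.

Lemma normal_pdf_gauss (P x : R) : 0 < P ->
  normal_pdf 0 (Num.sqrt (P / 2)) x = gauss_pdf P x.
Proof.
move=> P0; have P20 : 0 < P / 2 by rewrite divr_gt0.
rewrite normal_pdfE ?gt_eqF ?sqrtr_gt0// /normal_peak /normal_fun /gauss_pdf.
have P2 : P / 2 *+ 2 = P by rewrite -mulr_natr divfK.
by rewrite sqr_sqrtr ?(ltW P20)// -mulrnAl P2 subr0 (mulrC pi) [LHS]mulrC.
Qed.

(** A point mass for [P = 0], otherwise two independent real Gaussians of variance [P / 2]. These
    laws are the witnesses for the supremum and the infimum in the max-min value. *)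
Lemma exists_CN (P : R) : 0 <= P -> exists mu : probability (CC R) R, is_CN P mu.
Proof.
rewrite le_eqVlt => /predU1P[<-|P0].
  exists (\d_(0 : R * R)); split; last by rewrite ltxx.
  by move=> _ A mA.
pose np : probability (measurableTypeR R) R := normal_prob 0 (Num.sqrt (P / 2)).
pose X := @mfun_Sub _ _ (measurableTypeR R * measurableTypeR R)%type (R * R)%type _
  (mem_set measurable_idfun_plane).
exists (distribution (np \x np)%E X); split; first by move=> P'; rewrite P' ltxx in P0.
move=> _ A mA.
have npE (f : R -> \bar R) : measurable_fun [set: R] f -> (forall x, 0 <= f x)%E ->
    (\int[np]_x f x = \int[leb]_x (f x * (gauss_pdf P x)%:E))%E.
  move=> mf f0; apply: (@ge0_integral_density _ _ (measurableTypeR R)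
    (measurableTypeR R) R np leb idfun (gauss_pdf P)) => //.
  - by move=> _ B mB; rewrite setTI.
  - exact: measurable_gauss_pdf.
  - exact: gauss_pdf_ge0.
  move=> B mB; rewrite /np/= /normal_prob.
  rewrite [LHS]integral_mkcond; apply: eq_integral => x _.
  by rewrite patchE indicE normal_pdf_gauss//; case: ifPn; rewrite ?mul1r ?mul0r.
have mi : measurable_fun [set: R * R] (fun z => (\1_A z : R)%:E).
  by apply/measurable_EFinP; exact: measurable_indic.
have i0 z : (0 <= (\1_A z : R)%:E)%E by rewrite lee_fin.
rewrite /distribution /pushforward /=; have -> : (np \x np)%E A = (\int[np \x np]_z (\1_A z)%:E)%E.
  have mA' : measurable (A : set (measurableTypeR R * measurableTypeR R)) := mA.
  by rewrite (@integral_indic _ _ _ (np \x np)%E setT measurableT A mA') setIT.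

rewrite fubini_tonelli1//= npE; first last.
- by move=> x; exact: integral_ge0.
- exact: measurable_fun_fubini_tonelli_F.
apply: eq_integral => x _; rewrite /fubini_F npE//; first last.
- exact: (measurableT_comp mi (pair1_measurable x)).
rewrite -ge0_integralZr//; first last.
- by rewrite lee_fin gauss_pdf_ge0.
- by move=> y _; rewrite mule_ge0// lee_fin gauss_pdf_ge0.
- apply: emeasurable_funM; first exact: (measurableT_comp mi (pair1_measurable x)).
  by apply/measurable_EFinP; exact: measurable_gauss_pdf.
by apply: eq_integral => y _; rewrite -!EFinM cn_densityE//= -mulrA [X in _ * X]mulrC.
Qed.

End gaussian_plane.

(** * Divergence and averaging *)

Section divergence.
Context {R : realType}.

(** The inequality [ln x <= x - 1] at [x = q / p], multiplied by [p]. *)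
Lemma kl_integrand_ge0 (p q : R) : 0 < p -> 0 < q -> 0 <= kl_integrand p q.
Proof.
move=> p0 q0; rewrite /kl_integrand.
have qp0 : 0 < q / p by rewrite divr_gt0.
have : ln (q / p) <= q / p - 1.
  by have := @le_ln1Dx R (q / p - 1); rewrite [1 + _]addrC subrK; apply; lra.
rewrite -[p / q]invrK invf_div lnV ?posrE// => /(ler_wpM2l (ltW p0)).
rewrite mulrBr mulr1 mulrCA divff ?gt_eqF// mulr1; lra.
Qed.

(** Change of reference density. With nonnegativity of the left side it gives the variational
    inequality used for the lower bound. *)
Lemma kl_integrandMr (p q w : R) : 0 < p -> 0 < q -> 0 < w ->
  kl_integrand p (q * w) = kl_integrand p q - p * ln w - q + q * w.
Proof.
move=> p0 q0 w0; rewrite /kl_integrand.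
have -> : p / (q * w) = p / q / w by rewrite invfM mulrA.
by rewrite ln_div ?posrE ?divr_gt0//; ring.
Qed.

Context d (T : measurableType d) (mu : probability T R).

Lemma integral_probability_cst (c : \bar R) : (\int[mu]_x c = c)%E.
Proof.
rewrite integral_cst// -[RHS]mule1; congr (_ * _)%E; exact: (probability_setT mu).
Qed.

(** Shows that the [fine] in the definitions of the densities discards nothing, and that the
    averaged densities stay positive, so that their logarithms are meaningful. *)
Lemma integral_mean (f : T -> R) (C : R) : measurable_fun [set: T] f ->
  (forall x, 0 < f x <= C) ->
  [/\ (\int[mu]_x (f x)%:E = (fine (\int[mu]_x (f x)%:E))%:E)%E,
   0 < fine (\int[mu]_x (f x)%:E) & fine (\int[mu]_x (f x)%:E) <= C].
Proof.
move=> mf fC; have f0 x : (0 <= (f x)%:E)%E by rewrite lee_fin ltW//; case/andP: (fC x).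
have mfE : measurable_fun [set: T] (EFin \o f) by exact/measurable_EFinP.
have IC : (\int[mu]_x (f x)%:E <= C%:E)%E.
  rewrite -[leRHS]integral_probability_cst.
  apply: ge0_le_integral => //.
  by move=> x _; rewrite lee_fin; case/andP: (fC x).
have Ifin : (\int[mu]_x (f x)%:E)%E \is a fin_num.
  by rewrite ge0_fin_numE ?integral_ge0// (le_lt_trans IC)// ltry.
(* A zero mean would force [f] to vanish almost everywhere; as [f] is positive, the whole space
   would be null. *)
have I0 : (0 < \int[mu]_x (f x)%:E)%E.
  rewrite lt_neqAle integral_ge0// andbT eq_sym; apply/eqP => I0.
  have : (\int[mu]_x `|(f x)%:E| = 0)%E.
    by rewrite -I0; apply: eq_integral => x _; rewrite gee0_abs.
  move/(ae_eq_integral_abs _ measurableT mfE) => [A [mA A0 sA]].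
  have : (mu setT <= mu A)%E.
    apply: le_measure; rewrite ?inE// => x _; apply: sA => /= /(_ Logic.I).
    by case; apply/eqP; rewrite gt_eqF//; case/andP: (fC x).
  by rewrite A0 probability_setT lee_fin ler10.
split; first by rewrite fineK.
- by apply: fine_gt0; rewrite I0 ltey_eq Ifin.
- by rewrite -lee_fin fineK.
Qed.

Lemma measurable_kl_integrand (f g : T -> R) : measurable_fun [set: T] f ->
  measurable_fun [set: T] g -> (forall x, 0 < g x) ->
  measurable_fun [set: T] (fun x => kl_integrand (f x) (g x)).
Proof.
move=> mf mg g0; apply: measurable_funD => //; apply: measurable_funB => //.
apply: measurable_funM => //; apply: (measurableT_comp (@measurable_ln R)).
(* Division by the positive [g] is expressed through [expR] and [ln], whose measurability is
   known. *)
rewrite (_ : (fun x => _) = (fun x => f x * expR (- ln (g x)))); last first.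
  by apply/funext => x; rewrite expRN lnK ?posrE.
apply: measurable_funM => //; apply: measurableT_comp => //.
by apply: measurableT_comp => //; exact: measurableT_comp.
Qed.

(* The two sides differ by the divergence of the mean [q] from [g]; in the proof the terms [`|u|] keep
   all integrands nonnegative. *)
Lemma integral_kl_integrand_mean (f : T -> R) (C g : R) : measurable_fun [set: T] f ->
  (forall x, 0 < f x <= C) -> 0 < g ->
  (\int[mu]_x (kl_integrand (f x) (fine (\int[mu]_x (f x)%:E)))%:E <=
   \int[mu]_x (kl_integrand (f x) g)%:E)%E.
Proof.
move=> mf fC g0; have [qE q0 _] := integral_mean mf fC.
set q := fine _ in qE q0 *; pose u := ln (q / g).
have f0 x : 0 < f x by case/andP: (fC x).
have mc (c : R) : measurable_fun [set: T] (cst c) by exact: measurable_cst.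
have mk (c : R) : 0 < c -> measurable_fun [set: T] (EFin \o (fun x => kl_integrand (f x) c)).
  by move=> c0; apply/measurable_EFinP; apply: measurable_kl_integrand.
have affine (a c : R) : 0 <= a -> 0 <= c -> (\int[mu]_x (f x * a + c)%:E = (q * a + c)%:E)%E.
  move=> a0 c0; under eq_integral do rewrite EFinD EFinM.
  rewrite ge0_integralD//.
  2: by move=> x _; rewrite -EFinM lee_fin mulr_ge0// ltW.
  2: exact/measurable_EFinP/measurable_funM.
  rewrite ge0_integralZr//.
  2: exact/measurable_EFinP.
  2: by move=> x _; rewrite lee_fin ltW.
  by rewrite qE integral_probability_cst.
have maf (a c : R) : measurable_fun [set: T] (EFin \o (fun x => f x * a + c)).
  by apply/measurable_EFinP/measurable_funD => //; exact: measurable_funM.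
have afge0 (a c : R) : 0 <= a -> 0 <= c -> forall x, [set: T] x -> (0 <= (f x * a + c)%:E)%E.
  by move=> a0 c0 x _; rewrite lee_fin addr_ge0// mulr_ge0// ltW.
have u0 : 0 <= u + `|u| by rewrite -lerBlDl sub0r ler_normr lexx orbT.
have : (\int[mu]_x ((kl_integrand (f x) q)%:E + (f x * (u + `|u|) + g)%:E) =
        \int[mu]_x ((kl_integrand (f x) g)%:E + (f x * `|u| + q)%:E))%E.
  apply: eq_integral => x _; rewrite -!EFinD; congr EFin.
  have -> : kl_integrand (f x) q = kl_integrand (f x) (g * (q / g)).
    by congr kl_integrand; field; rewrite gt_eqF.
  rewrite kl_integrandMr ?divr_gt0// -/u (_ : g * (q / g) = q); first by ring.
  by field; rewrite gt_eqF.
rewrite !ge0_integralD//=.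
2: by move=> x _; rewrite lee_fin kl_integrand_ge0.
2: exact: mk.
2: by apply: afge0 => //; exact: ltW.
2: exact: maf.
2: by move=> x _; rewrite lee_fin kl_integrand_ge0.
2: exact: mk.
2: by apply: afge0 => //; exact: ltW.
2: exact: maf.
rewrite !affine ?(ltW g0) ?(ltW q0)// => E.
(* This is [0 <= kl_integrand q g] with the absolute-value term added on both sides; the finite left
   side is then cancelled in [E]. *)
have qg : ((q * `|u| + q)%:E <= (q * (u + `|u|) + g)%:E)%E.
  rewrite lee_fin; have := kl_integrand_ge0 q0 g0.
  by rewrite /kl_integrand -/u; lra.
rewrite -(@leeD2rE _ (q * `|u| + q)%:E)//.
by apply: le_trans (leeD2l _ qg) _; rewrite E.
Qed.

End divergence.

(** * Joint integrals over input and output *)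

Section double_integral.
Context {R : realType}.
Local Notation leb := (@lebesgue_measure R).
Local Notation leb2 := (leb \x leb)%E.
Variable mu : probability (CC R) R.
Implicit Types F G : R * R -> R * R -> R.

Definition double_integral F := (\int[mu]_s \int[leb2]_r (F s r)%:E)%E.

(** The hypotheses of Tonelli's theorem, bundled so that they propagate through sums and
    products. *)
Definition ge0_measurable2 F :=
  measurable_fun [set: (R * R) * (R * R)] (fun p => F p.1 p.2) /\ forall s r, 0 <= F s r.

Let section_measurable F s : ge0_measurable2 F ->
  measurable_fun [set: measurableTypeR R * measurableTypeR R] (fun r => (F s r)%:E).
Proof.
move=> [mF _]; have H : measurable_fun [set: R * R] (F s).
  exact: (measurableT_comp mF (pair1_measurable s)).
by have /measurable_EFinP := H; exact.
Qed.

Let inner_measurable F : ge0_measurable2 F ->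
  measurable_fun [set: R * R] (fun s => \int[leb2]_r (F s r)%:E)%E.
Proof.
move=> [mF F0]; apply: (@measurable_integral_plane _ _ _ (fun s r => (F s r)%:E)).
  exact/measurable_EFinP.
by move=> s r; rewrite lee_fin.
Qed.

Lemma double_integralD F G : ge0_measurable2 F -> ge0_measurable2 G ->
  (double_integral (fun s r => F s r + G s r)%R = double_integral F + double_integral G)%E.
Proof.
move=> hF hG; have [_ F0] := hF; have [_ G0] := hG.
rewrite /double_integral -ge0_integralD//.
- apply: eq_integral => s _; under eq_integral do rewrite EFinD.
  rewrite ge0_integralD//.
  + by move=> r _; rewrite lee_fin.
  + exact: section_measurable.
  + by move=> r _; rewrite lee_fin.
  + exact: section_measurable.
- by move=> s _; apply: integral_ge0 => r _; rewrite lee_fin.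
- exact: inner_measurable.
- by move=> s _; apply: integral_ge0 => r _; rewrite lee_fin.
- exact: inner_measurable.
Qed.

Lemma le_double_integral F G : ge0_measurable2 F -> ge0_measurable2 G ->
  (forall s r, F s r <= G s r) -> (double_integral F <= double_integral G)%E.
Proof.
move=> hF hG FG; have [_ F0] := hF; have [_ G0] := hG.
apply: ge0_le_integral => //.
- by move=> s _; apply: integral_ge0 => r _; rewrite lee_fin.
- exact: inner_measurable.
- exact: inner_measurable.
move=> s _; apply: ge0_le_integral => //.
- by move=> r _; rewrite lee_fin.
- exact: section_measurable.
- exact: section_measurable.
- by move=> r _; rewrite lee_fin.
Qed.

Lemma double_integralZ (c : R) F : 0 <= c -> ge0_measurable2 F ->
  (double_integral (fun s r => c * F s r)%R = c%:E * double_integral F)%E.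
Proof.
move=> c0 hF; have [_ F0] := hF.
rewrite /double_integral -ge0_integralZl//.
- apply: eq_integral => s _; under eq_integral do rewrite EFinM.
  rewrite ge0_integralZl//.
  + exact: section_measurable.
  + by move=> r _; rewrite lee_fin.
- exact: inner_measurable.
- by move=> s _; apply: integral_ge0 => r _; rewrite lee_fin.
Qed.

Lemma double_integral_swap F : ge0_measurable2 F ->
  (double_integral F = \int[leb2]_r \int[mu]_s (F s r)%:E)%E.
Proof.
move=> [mF F0]; apply: (@tonelli_plane _ _ _ (fun s r => (F s r)%:E)).
  exact/measurable_EFinP.
by move=> s r; rewrite lee_fin.
Qed.

Lemma ge0_measurable2D F G : ge0_measurable2 F -> ge0_measurable2 G ->
  ge0_measurable2 (fun s r => F s r + G s r).
Proof.
by move=> [mF F0] [mG G0]; split; [exact: measurable_funD|move=> s r; rewrite addr_ge0].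
Qed.

Lemma ge0_measurable2M F G : ge0_measurable2 F -> ge0_measurable2 G ->
  ge0_measurable2 (fun s r => F s r * G s r).
Proof.
by move=> [mF F0] [mG G0]; split; [exact: measurable_funM|move=> s r; rewrite mulr_ge0].
Qed.

Lemma ge0_measurable2_cst (c : R) : 0 <= c -> ge0_measurable2 (fun _ _ => c).
Proof. by move=> c0; split. Qed.

End double_integral.

(** * The channel *)

Section rotation.
Context {R : realType}.
Implicit Types z j : R * R.

Definition unrot (M i : nat) z : R * R :=
  let t := 2 * pi * i%:R / M%:R in
  (z.1 * cos t + z.2 * sin t, z.2 * cos t - z.1 * sin t).

Lemma csq_unrot M i z : csq (unrot M i z) = csq z.
Proof.
rewrite /csq /unrot /=; set t := _ / _.
have E : cos t ^+ 2 = 1 - sin t ^+ 2 by rewrite -(cos2Dsin2 t) addrK.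
by ring: E.
Qed.

Lemma csq_rot M i j : csq (Defs.rot M i j) = csq j.
Proof.
rewrite /csq /Defs.rot /=; set t := _ / _.
have E : cos t ^+ 2 = 1 - sin t ^+ 2 by rewrite -(cos2Dsin2 t) addrK.
by ring: E.
Qed.

(** Rotations are isometries: the phase is moved from the jammer's symbol to the observation, which
    leaves a plain convolution in [j]. *)
Lemma csq_subr_rot M i z j : csq (z - Defs.rot M i j) = csq (unrot M i z - j).
Proof.
rewrite /csq /Defs.rot /unrot /=; set t := _ / _.
have E : cos t ^+ 2 = 1 - sin t ^+ 2 by rewrite -(cos2Dsin2 t) addrK.
by ring: E.
Qed.

Lemma cn_density_csq (A : R) z j : csq z = csq j -> cn_density A z = cn_density A j.
Proof. by rewrite /cn_density => ->. Qed.

Lemma cn_density_ratio (A B : R) z j : 0 < A -> 0 < B ->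
  cn_density A z / cn_density B j = B / A * expR (csq j / B - csq z / A).
Proof.
move=> A0 B0; rewrite /cn_density expRD !mulNr !expRN.
have pi0 : pi != 0 :> R by rewrite gt_eqF ?pi_gt0.
move: (pi : R) pi0 => w w0.
by field; rewrite w0 !gt_eqF ?expR_gt0.
Qed.

Lemma ln_cn_density_ratio (A B : R) z j : 0 < A -> 0 < B ->
  ln (cn_density A z / cn_density B j) = ln (B / A) + csq j / B - csq z / A.
Proof.
move=> A0 B0; rewrite cn_density_ratio// lnM ?posrE ?expR_gt0 ?divr_gt0//.
by rewrite expRK addrA.
Qed.

End rotation.

(** * The channel kernel for a fixed jammer symbol *)

Section channel.
Context {R : realType}.
Local Notation leb := (@lebesgue_measure R).
Local Notation leb2 := (leb \x leb)%E.
Variables (M : nat) (PN : R).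
Hypotheses (M0 : (0 < M)%N) (PN0 : 0 < PN).
Implicit Types (z j s r t : R * R).

(** Density at [z] of the total noise when the jammer sends [j], averaged over the phases. *)
Definition kernel z j : R := M%:R^-1 * \sum_(i < M) cn_density PN (z - Defs.rot M i j).

Let MR0 : 0 < M%:R :> R. Proof. by rewrite ltr0n. Qed.

Lemma kernel_bounds z j : 0 < kernel z j <= (pi * PN)^-1.
Proof.
apply/andP; split.
  (* A single phase, the one of index 0, already makes the sum positive. *)
  rewrite mulr_gt0 ?invr_gt0// (bigD1 (Ordinal M0))//=.
  rewrite ltr_pwDl ?cn_density_gt0// sumr_ge0// => i _.
  exact: cn_density_ge0.
rewrite /kernel mulrC ler_pdivrMr// mulr_natr -[X in _ *+ X]card_ord -sumr_const.
by apply: ler_sum => i _; exact: cn_density_ub.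
Qed.

Lemma measurable_kernel d (X : measurableType d) (u v : X -> R * R) :
  measurable_fun [set: X] u -> measurable_fun [set: X] v ->
  measurable_fun [set: X] (fun x => kernel (u x) (v x)).
Proof.
move=> mu mv; apply: measurable_funM => //; apply: measurable_sum => i.
by apply: measurable_cn_density; apply: measurable_funB2 => //; exact: measurable_rot.
Qed.

Let integral_average d (X : measurableType d) (nu : {measure set X -> \bar R})
    (h : nat -> X -> R) (a : 'I_M -> R) :
  (forall i, measurable_fun [set: X] (h i)) -> (forall i x, 0 <= h i x) ->
  (forall i : 'I_M, \int[nu]_x (h i x)%:E = (a i)%:E)%E ->
  (\int[nu]_x (M%:R^-1 * \sum_(i < M) h i x)%:E = (M%:R^-1 * \sum_(i < M) a i)%:E)%E.
Proof.
move=> mh h0 aE.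
have mg i : measurable_fun [set: X] (EFin \o h i) by exact/measurable_EFinP.
transitivity (\int[nu]_x ((M%:R^-1)%:E * \sum_(i < M) (h i x)%:E))%E.
  by apply: eq_integral => x _; rewrite sumEFin -EFinM.
rewrite ge0_integralZl//.
- rewrite ge0_integral_sum//.
  2: by move=> i; exact: mg.
  2: by move=> i x _; rewrite lee_fin.
  rewrite EFinM -sumEFin; congr (_ * _)%E.
  by apply: eq_bigr => i _; rewrite aE.
- by apply: emeasurable_sum => i; exact: mg.
- by move=> x _; apply: sume_ge0 => i _; rewrite lee_fin.
Qed.

(** Reduces weighted integrals of [kernel] to one Gaussian integral per phase. The variable may sit
    in the observation or in the jammer's symbol, and the weight [h] is 1 or a squared distance. *)
Let integral_kernel_prod d (X : measurableType d) (nu : {measure set X -> \bar R})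
    (u v : X -> R * R) (h : X -> R) (a : 'I_M -> R) :
  measurable_fun [set: X] u -> measurable_fun [set: X] v ->
  measurable_fun [set: X] h -> (forall x, 0 <= h x) ->
  (forall i : 'I_M, \int[nu]_x (cn_density PN (u x - Defs.rot M i (v x)) * h x)%:E = (a i)%:E)%E ->
  (\int[nu]_x (kernel (u x) (v x) * h x)%:E = (M%:R^-1 * \sum_(i < M) a i)%:E)%E.
Proof.
move=> mu mv mh h0 aE.
rewrite -(@integral_average _ _ nu
  (fun i x => cn_density PN (u x - Defs.rot M i (v x)) * h x) a _ _ aE).
- by apply: eq_integral => x _; rewrite /kernel -mulrA mulr_suml.
- move=> i; apply: measurable_funM => //.
  by apply: measurable_cn_density; apply: measurable_funB2 => //; exact: measurable_rot.
- by move=> i x; rewrite mulr_ge0// cn_density_ge0.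
Qed.

Let sum_cstM (c : R) : M%:R^-1 * \sum_(i < M) c = c.
Proof. by rewrite sumr_const card_ord -[c *+ M]mulr_natl mulKf// gt_eqF. Qed.

Lemma integral_kernel s j : (\int[leb2]_r (kernel (r - s) j)%:E = 1)%E.
Proof.
under eq_integral do rewrite -[kernel _ _]mulr1.
rewrite (@integral_kernel_prod _ _ leb2 (fun r => r - s) (fun=> j) (fun=> 1) (fun=> 1))//.
- by rewrite sum_cstM.
- by apply: measurable_funB2; [exact: measurable_id|exact: measurable_cst].
- move=> i; under eq_integral do rewrite mulr1 -addrA -opprD.
  exact: integral_cn_density.
Qed.

Lemma integral_kernel_csq s j t :
  (\int[leb2]_r (kernel (r - s) j * csq (r - t))%:E =
   (M%:R^-1 * \sum_(i < M) (PN + csq (s + Defs.rot M i j - t)))%:E)%E.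
Proof.
apply: (@integral_kernel_prod _ _ leb2 (fun r => r - s) (fun=> j) (fun r => csq (r - t))).
- by apply: measurable_funB2; [exact: measurable_id|exact: measurable_cst].
- exact: measurable_cst.
- by apply: measurable_csq; apply: measurable_funB2; [exact: measurable_id|exact: measurable_cst].
- by move=> r; exact: csq_ge0.
- move=> i; under eq_integral do rewrite -addrA -opprD.
  exact: integral_cn_density_csq.
Qed.

(** * Conditional and output densities *)

Section output.
Variables FS FJ : probability (CC R) R.
Local Notation p := (cond_density M PN FJ).
Local Notation q := (out_density M PN FS FJ).

Let mean_cn z i : exists a : R,
  (\int[FJ]_j (cn_density PN (z - Defs.rot M i j))%:E = a%:E)%E.
Proof.
have [E _ _] := @integral_mean _ _ _ FJ (fun j => cn_density PN (z - Defs.rot M i j)) (pi * PN)^-1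
  (measurable_cn_density PN (measurable_funB2 (measurable_cst z)
    (measurable_rot M i (@measurable_id _ _ _))))
  (fun j => introT andP (conj (cn_density_gt0 _ PN0) (cn_density_ub _ PN0))).
by eexists; exact: E.
Qed.

(** Each phase has a finite mean because the Gaussian density is bounded, so the finite sum and the
    average over the jammer commute. *)
Lemma cond_densityE s r : ((p s r)%:E = \int[FJ]_j (kernel (r - s) j)%:E)%E.
Proof.
under eq_integral do rewrite -[kernel _ _]mulr1.
rewrite (@integral_kernel_prod _ _ FJ (fun=> r - s) idfun (fun=> 1)
  (fun i => fine (\int[FJ]_j (cn_density PN (r - s - Defs.rot M i j))%:E)))//.
- exact: measurable_id.
- move=> i; have [a aE] := mean_cn (r - s) i.
  by under eq_integral do rewrite mulr1; rewrite /= aE.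
Qed.

Lemma cond_density_bounds s r : 0 < p s r <= (pi * PN)^-1.
Proof.
have [E l u] := @integral_mean _ _ _ FJ (kernel (r - s)) (pi * PN)^-1
  (measurable_kernel (measurable_cst _) (@measurable_id _ _ _)) (kernel_bounds _).
by rewrite -cond_densityE /= in l u; rewrite l u.
Qed.

Lemma cond_density_ge0_measurable2 : ge0_measurable2 p.
Proof.
split; last by move=> s r; have /andP[/ltW] := cond_density_bounds s r.
apply/measurable_EFinP.
rewrite (_ : EFin \o _ = fun u => (\int[FJ]_j (kernel (u.2 - u.1) j)%:E)%E); last first.
  by apply/funext => u; rewrite /= cond_densityE.
apply: (@measurable_fun_fubini_tonelli_F _ _ ((R * R) * (R * R))%type (R * R)%type R FJ
  (fun w => (kernel (w.1.2 - w.1.1) w.2)%:E)).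
- apply/measurable_EFinP/measurable_kernel; last exact: measurable_snd.
  apply: measurable_funB2.
    exact: (measurableT_comp measurable_snd measurable_fst).
  exact: (measurableT_comp measurable_fst measurable_fst).
- by move=> w; rewrite lee_fin; have /andP[/ltW] := kernel_bounds (w.1.2 - w.1.1) w.2.
Qed.

Let mp s : measurable_fun [set: R * R] (p s).
Proof. exact: (measurableT_comp cond_density_ge0_measurable2.1 (pair1_measurable s)). Qed.

Let mps r : measurable_fun [set: R * R] (p ^~ r).
Proof. exact: (measurableT_comp cond_density_ge0_measurable2.1 (pair2_measurable r)). Qed.

Lemma out_densityE r : ((q r)%:E = \int[FS]_s (p s r)%:E)%E.
Proof.
by have [<-] := @integral_mean _ _ _ FS (p ^~ r) (pi * PN)^-1 (mps r)
  (fun s => cond_density_bounds s r).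
Qed.

Lemma out_density_gt0 r : 0 < q r.
Proof.
by have [] := @integral_mean _ _ _ FS (p ^~ r) (pi * PN)^-1 (mps r)
  (fun s => cond_density_bounds s r).
Qed.

Lemma measurable_out_density : measurable_fun [set: R * R] q.
Proof.
apply/measurable_EFinP.
rewrite (_ : EFin \o _ = fun r => (\int[FS]_s (p s r)%:E)%E); last first.
  by apply/funext => r; rewrite /= out_densityE.
apply: (@measurable_fun_fubini_tonelli_G _ _ (R * R)%type (R * R)%type R FS
  (fun w => (p w.1 w.2)%:E)).
- by apply/measurable_EFinP; exact: cond_density_ge0_measurable2.1.
- by move=> w; rewrite lee_fin; exact: cond_density_ge0_measurable2.2.
Qed.

Lemma kl_ge0_measurable2 (g : R * R -> R) : measurable_fun [set: R * R] g ->
  (forall r, 0 < g r) -> ge0_measurable2 (fun s r => kl_integrand (p s r) (g r)).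
Proof.
move=> mg g0; split.
  apply: measurable_kl_integrand => //; first exact: cond_density_ge0_measurable2.1.
  exact: (measurableT_comp mg measurable_snd).
move=> s r; apply: kl_integrand_ge0 => //.
by have /andP[] := cond_density_bounds s r.
Qed.

Lemma mutual_infoE (b : R) : (mutual_info b M PN FS FJ =
  double_integral FS (fun s r => kl_integrand (p s r) (q r)) * ((ln b)^-1)%:E)%E.
Proof.
rewrite /mutual_info; congr (_ * _)%E; apply: eq_integral => s _.
have [mk k0] := kl_ge0_measurable2 measurable_out_density out_density_gt0.
apply: (@integral_plane _ (fun r => (kl_integrand (p s r) (q r))%:E)).
  by apply/measurable_EFinP; exact: (measurableT_comp mk (pair1_measurable s)).
by move=> r; rewrite lee_fin.
Qed.

(** After exchanging the integrals, the output density at each [r] is the mean of [p ^~ r] under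
    [FS], and the mean minimises the average divergence. *)
Lemma double_integral_kl_mean (g : R * R -> R) : measurable_fun [set: R * R] g ->
  (forall r, 0 < g r) ->
  (double_integral FS (fun s r => kl_integrand (p s r) (q r)) <=
   double_integral FS (fun s r => kl_integrand (p s r) (g r)))%E.
Proof.
move=> mg g0.
have hq := kl_ge0_measurable2 measurable_out_density out_density_gt0.
have hg := kl_ge0_measurable2 mg g0.
rewrite !double_integral_swap//; apply: ge0_le_integral => //.
- by move=> r _; apply: integral_ge0 => s _; rewrite lee_fin hq.2.
- apply: (@measurable_fun_fubini_tonelli_G _ _ (R * R)%type (R * R)%type R FS
    (fun w => (kl_integrand (p w.1 w.2) (q w.2))%:E)).
  + by apply/measurable_EFinP; exact: hq.1.
  + by move=> w; rewrite lee_fin hq.2.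
- apply: (@measurable_fun_fubini_tonelli_G _ _ (R * R)%type (R * R)%type R FS
    (fun w => (kl_integrand (p w.1 w.2) (g w.2))%:E)).
  + by apply/measurable_EFinP; exact: hg.1.
  + by move=> w; rewrite lee_fin hg.2.
- move=> r _; exact: (@integral_kl_integrand_mean _ _ _ FS (p ^~ r) (pi * PN)^-1 (g r) (mps r)
    (fun s => cond_density_bounds s r) (g0 r)).
Qed.

(** Tonelli's theorem over output and jammer: a moment of the output is first computed for a fixed
    jammer symbol, then averaged. *)
Let integral_cond_density_prod (h : R * R -> R) s (a : R * R -> R) :
  measurable_fun [set: R * R] h -> (forall r, 0 <= h r) ->
  (forall j, \int[leb2]_r (kernel (r - s) j * h r)%:E = (a j)%:E)%E ->
  (\int[leb2]_r (p s r * h r)%:E = \int[FJ]_j (a j)%:E)%E.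
Proof.
move=> mh h0 aE.
have mk : measurable_fun [set: (R * R) * (R * R)] (fun u => (kernel (u.2 - s) u.1 * h u.2)%:E).
  apply/measurable_EFinP/measurable_funM; last exact: (measurableT_comp mh measurable_snd).
  apply: measurable_kernel; last exact: measurable_fst.
  by apply: measurable_funB2; [exact: measurable_snd|exact: measurable_cst].
have k0 z j : 0 <= kernel z j by have /andP[/ltW] := kernel_bounds z j.
transitivity (\int[leb2]_r \int[FJ]_j (kernel (r - s) j * h r)%:E)%E.
  apply: eq_integral => r _; rewrite EFinM cond_densityE -ge0_integralZr//.
  - by apply/measurable_EFinP/measurable_kernel; [exact: measurable_cst|exact: measurable_id].
  - by move=> j _; rewrite lee_fin.
  - by rewrite lee_fin.
have kh0 j r : (0 <= (kernel (r - s) j * h r)%:E)%E by rewrite lee_fin mulr_ge0.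
transitivity (\int[FJ]_j \int[leb2]_r (kernel (r - s) j * h r)%:E)%E.
  by apply/esym; exact: (@tonelli_plane _ _ _ (fun j r => (kernel (r - s) j * h r)%:E) mk kh0 FJ).
by apply: eq_integral => j _; exact: aE.
Qed.

Lemma integral_cond_density s : (\int[leb2]_r (p s r)%:E = 1)%E.
Proof.
under eq_integral do rewrite -[p _ _]mulr1.
rewrite (integral_cond_density_prod (a := fun=> 1))//.
  by rewrite integral_probability_cst.
by move=> j; under eq_integral do rewrite mulr1; exact: integral_kernel.
Qed.

Lemma integral_cond_density_csq s t : (\int[leb2]_r (p s r * csq (r - t))%:E =
  \int[FJ]_j (M%:R^-1 * \sum_(i < M) (PN + csq (s + Defs.rot M i j - t)))%:E)%E.
Proof.
apply: integral_cond_density_prod.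
- by apply: measurable_csq; apply: measurable_funB2; [exact: measurable_id|exact: measurable_cst].
- by move=> r; exact: csq_ge0.
- by move=> j; exact: integral_kernel_csq.
Qed.

End output.

(** * The two saddle inequalities *)

Section saddle.
Variables (PS PJ : R).
Hypotheses (PS0 : 0 < PS) (PJ0 : 0 <= PJ).
Local Notation V := (PJ + PN).
Local Notation W := (PS + (PJ + PN)).

Let V0 : 0 < V. Proof. by rewrite ltr_wpDl. Qed.
Let W0 : 0 < W. Proof. by rewrite addr_gt0. Qed.
(** The saddle value in natural units, since [W / V = 1 + PS / (PJ + PN)]. *)
Let c := ln (W / V).

Let c0 : 0 <= c.
Proof. by rewrite /c ln_ge0// ler_pdivlMr// mul1r lerDr ltW. Qed.

Let measurable_cn (A : R) : measurable_fun [set: R * R] (fun r => cn_density A r).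
Proof. by apply: measurable_cn_density; exact: measurable_id. Qed.

Let ge0_measurable2_csqB : ge0_measurable2 (fun s r => csq (r - s)).
Proof.
split; last by move=> s r; exact: csq_ge0.
by apply: measurable_csq; apply: measurable_funB2; [exact: measurable_snd|exact: measurable_fst].
Qed.

Let ge0_measurable2_csq : @ge0_measurable2 R (fun s r => csq r).
Proof.
by split; [apply: measurable_csq; exact: measurable_snd|move=> s r; exact: csq_ge0].
Qed.

Let ge0_measurable2Z (k : R) F : 0 <= k -> ge0_measurable2 F ->
  ge0_measurable2 (fun s r => k * F s r).
Proof. by move=> k0 hF; apply: ge0_measurable2M => //; exact: ge0_measurable2_cst. Qed.

(** Circular symmetry: for each phase the convolution gives variance [PJ + PN] at a rotated point,
    with the same modulus. All phases contribute the same value. *)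
Lemma cond_density_CN (FJ : probability (CC R) R) s r : is_CN PJ FJ ->
  cond_density M PN FJ s r = cn_density V (r - s).
Proof.
move=> CNJ; apply: EFin_inj; rewrite cond_densityE.
under eq_integral do rewrite -[kernel _ _]mulr1.
rewrite (@integral_kernel_prod _ _ FJ (fun=> r - s) idfun (fun=> 1)
  (fun=> cn_density V (r - s)))//.
- by rewrite sum_cstM.
- exact: measurable_id.
- move=> i; under eq_integral do rewrite mulr1 (cn_density_csq _ (csq_subr_rot _ _ _ _)).
  rewrite (integral_CN_cn_density _ PJ0 PN0 CNJ); congr EFin.
  by apply: cn_density_csq; rewrite csq_unrot.
Qed.

Lemma double_integral_kl_CN_ub (FS FJ : probability (CC R) R) :
  power_le PS FS -> is_CN PJ FJ ->
  (double_integral FS (fun s r => kl_integrand (cond_density M PN FJ s r)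
     (out_density M PN FS FJ r)) <= c%:E)%E.
Proof.
move=> FSP CNJ.
apply: le_trans (double_integral_kl_mean FS FJ (measurable_cn W) (fun r => cn_density_gt0 r W0)) _.
have hp := cond_density_ge0_measurable2 FJ.
set p := cond_density M PN FJ in hp *.
have pE s r : p s r = cn_density V (r - s) by exact: cond_density_CN.
have hg : @ge0_measurable2 R (fun s r => cn_density W r).
  split; first exact: (measurableT_comp (measurable_cn W) measurable_snd).
  by move=> s r; exact: cn_density_ge0.
have hk : ge0_measurable2 (fun s r => kl_integrand (p s r) (cn_density W r)).
  by apply: kl_ge0_measurable2 => // r; exact: cn_density_gt0.
have ha := ge0_measurable2M hp ge0_measurable2_csqB.
have hb := ge0_measurable2M hp ge0_measurable2_csq.
have Vi0 : 0 <= V^-1 by rewrite invr_ge0 ltW.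
have Wi0 : 0 <= W^-1 by rewrite invr_ge0 ltW.
have Tp : double_integral FS p = 1%E.
  rewrite /double_integral; under eq_integral do rewrite integral_cond_density.
  by rewrite integral_probability_cst.
have Ta : double_integral FS (fun s r => p s r * csq (r - s)) = V%:E.
  rewrite /double_integral; under eq_integral => s _.
    under eq_integral do rewrite pE.
    rewrite integral_cn_density_csq// subrr (_ : csq _ = 0) ?addr0; last first.
      by rewrite /csq/=; ring.
    over.
  by rewrite integral_probability_cst.
(* The output power is [V] plus the input power; the power constraint on [FS] enters here. *)
have Tb : (double_integral FS (fun s r => p s r * csq r)%R <= W%:E)%E.
  rewrite /double_integral; under eq_integral => s _.
    under eq_integral => r _ do rewrite pE -[X in csq X](subr0 r).
    rewrite integral_cn_density_csq// subr0 EFinD.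
    over.
  rewrite ge0_integralD//; last 3 first.
  - by move=> s _; rewrite lee_fin ltW.
  - by move=> s _; rewrite lee_fin csq_ge0.
  - by apply/measurable_EFinP/measurable_csq; exact: measurable_id.
  rewrite integral_probability_cst.
  have -> : W%:E = (V%:E + PS%:E)%E by rewrite -EFinD; congr EFin; rewrite [RHS]addrC.
  exact: leeD2l.
have Tg : double_integral FS (fun s r => cn_density W r) = 1%E.
  rewrite /double_integral; under eq_integral => s _.
    under eq_integral => r _ do rewrite -[X in cn_density _ X](subr0 r).
    rewrite integral_cn_density//.
    over.
  by rewrite integral_probability_cst.
(* The logarithm of the ratio of the two Gaussians is [c + csq r / W - csq (r - s) / V]; the
   negative terms are moved to the left. *)
have : double_integral FS (fun s r => kl_integrand (p s r) (cn_density W r) +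
    (V^-1 * (p s r * csq (r - s)) + p s r)) =
  double_integral FS (fun s r => c * p s r + (W^-1 * (p s r * csq r) + cn_density W r)).
  congr double_integral; apply/funext => s; apply/funext => r.
  rewrite /kl_integrand pE ln_cn_density_ratio// -/c.
  by field; rewrite !gt_eqF.
have hVa := ge0_measurable2Z Vi0 ha.
have hWb := ge0_measurable2Z Wi0 hb.
have hcp := ge0_measurable2Z c0 hp.
rewrite (double_integralD _ hk (ge0_measurable2D hVa hp)) (double_integralD _ hVa hp).
rewrite (double_integralD _ hcp (ge0_measurable2D hWb hg)) (double_integralD _ hWb hg).
rewrite (double_integralZ _ Vi0 ha) (double_integralZ _ Wi0 hb) (double_integralZ _ c0 hp).
rewrite Tp Ta Tg mule1 -EFinM mulVf ?gt_eqF// => E.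
(* The added left-hand terms integrate to 1 each and [Tb] bounds the scaled output power by 1, so
   the constants cancel. *)
rewrite -(@leeD2rE _ (1 + 1)%:E)// EFinD E leeD2l// leeD2r//.
apply: (@le_trans _ _ (W^-1%:E * W%:E)%E); first by rewrite lee_wpmul2l// lee_fin.
by rewrite -EFinM mulVf// gt_eqF.
Qed.

Let measurable_funD2 d (X : measurableType d) (u v : X -> R * R) :
  measurable_fun [set: X] u -> measurable_fun [set: X] v ->
  measurable_fun [set: X] (fun x => u x + v x).
Proof.
move=> mu mv; apply/measurable_fun_pairP; split.
  apply: measurable_funD; exact: measurableT_comp.
apply: measurable_funD; exact: measurableT_comp.
Qed.

(** The Gaussian input is centred, so no cross term with [v] survives. *)
Let integral_CN_csqD (FS : probability (CC R) R) (v : R * R) : is_CN PS FS ->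
  (\int[FS]_s (PN + csq (s + v))%:E = (PN + (PS + csq v))%:E)%E.
Proof.
move=> CNS.
have E s : ((PN + csq (s + v))%:E = PN%:E + (csq (s - - v))%:E)%E by rewrite opprK EFinD.
under eq_integral do rewrite E.
rewrite ge0_integralD//.
- rewrite integral_probability_cst (integral_CN_csq _ (ltW PS0) CNS) -EFinD.
  by congr EFin; rewrite /csq/= !sqrrN.
- by move=> s _; rewrite lee_fin ltW.
- by move=> s _; rewrite lee_fin csq_ge0.
- apply/measurable_EFinP/measurable_csq/measurable_funB2.
    exact: measurable_id.
  exact: measurable_cst.
Qed.

Lemma double_integral_kl_CN_lb (FS FJ : probability (CC R) R) :
  is_CN PS FS -> power_le PJ FJ ->
  (c%:E <= double_integral FS (fun s r => kl_integrand (cond_density M PN FJ s r)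
     (out_density M PN FS FJ r)))%E.
Proof.
move=> CNS FJP.
have hp := cond_density_ge0_measurable2 FJ.
have p0 s r : 0 < cond_density M PN FJ s r by have /andP[] := cond_density_bounds FJ s r.
have q0 := out_density_gt0 FS FJ.
have mq := measurable_out_density FS FJ.
have hk := kl_ge0_measurable2 FJ mq q0.
have qE := out_densityE FS FJ.
set p := cond_density M PN FJ in hp p0 hk qE *.
set q := out_density M PN FS FJ in q0 mq hk qE *.
(* The likelihood ratio of the Gaussian channel, used as a test function although the actual noise
   is arbitrary. *)
pose w s r := cn_density V (r - s) / cn_density W r.
have w0 s r : 0 < w s r by rewrite divr_gt0// cn_density_gt0.
have hq : @ge0_measurable2 R (fun s r => q r).
  by split; [exact: (measurableT_comp mq measurable_snd)|move=> s r; exact: ltW].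
have hw : ge0_measurable2 w.
  split; last by move=> s r; exact: ltW.
  rewrite (_ : (fun u => _) = fun u => W / V * expR (W^-1 * csq u.2 - V^-1 * csq (u.2 - u.1))).
    apply: measurable_funM => //; apply: measurableT_comp => //.
    apply: measurable_funB; apply: measurable_funM => //.
      exact: ge0_measurable2_csq.1.
    exact: ge0_measurable2_csqB.1.
  by apply/funext => u; rewrite /w cn_density_ratio// [W^-1 * _]mulrC [V^-1 * _]mulrC.
have hqw := ge0_measurable2M hq hw.
have ha := ge0_measurable2M hp ge0_measurable2_csqB.
have hb := ge0_measurable2M hp ge0_measurable2_csq.
have Vi0 : 0 <= V^-1 by rewrite invr_ge0 ltW.
have Wi0 : 0 <= W^-1 by rewrite invr_ge0 ltW.
have mcsq : measurable_fun [set: R * R] (fun z => (csq z)%:E).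
  by apply/measurable_EFinP/measurable_csq; exact: measurable_id.
have csqD (k : R) : 0 <= k -> (\int[FJ]_j (k + csq j)%:E = k%:E + \int[FJ]_j (csq j)%:E)%E.
  move=> k0; under eq_integral do rewrite EFinD.
  rewrite ge0_integralD//; last first.
  - by move=> s _; rewrite lee_fin csq_ge0.
  by rewrite integral_probability_cst.
(* The power constraint makes the jammer's power a real number, so the final comparison takes place
   in the reals. *)
have [e eE] : exists e : R, (\int[FJ]_j (csq j)%:E = e%:E)%E.
  exists (fine (\int[FJ]_j (csq j)%:E)); rewrite fineK// ge0_fin_numE.
    by rewrite (le_lt_trans FJP)// ltry.
  by apply: integral_ge0 => j _; rewrite lee_fin csq_ge0.
have ePJ : e <= PJ by move: FJP; rewrite /power_le eE lee_fin.
have Tp : double_integral FS p = 1%E.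
  rewrite /double_integral; under eq_integral do rewrite integral_cond_density.
  by rewrite integral_probability_cst.
have Tq : double_integral FS (fun s r => q r) = 1%E.
  rewrite /double_integral integral_probability_cst.
  rewrite -Tp double_integral_swap//.
  by apply: eq_integral => r _; rewrite qE.
(* For fixed [r], averaging [cn_density V (r - s)] over the Gaussian input gives [cn_density W r],
   so [w] has mean 1 and the mass of [q] remains. *)
have Tqw : double_integral FS (fun s r => q r * w s r) = 1%E.
  rewrite double_integral_swap// -[RHS]Tq /double_integral integral_probability_cst.
  apply: eq_integral => r _.
  under eq_integral => s _ do rewrite /w mulrC -mulrA mulrC EFinM.
  rewrite ge0_integralZl//.
  - rewrite (integral_CN_cn_density _ (ltW PS0) V0 CNS) -EFinM; congr EFin.
    by rewrite mulrAC mulVf ?mul1r// gt_eqF// cn_density_gt0.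
  - apply/measurable_EFinP/measurable_cn_density.
    by apply: measurable_funB2; [exact: measurable_cst|exact: measurable_id].
  - by move=> s _; rewrite lee_fin cn_density_ge0.
  - by rewrite lee_fin mulr_ge0 ?invr_ge0 ?(ltW (q0 _)) ?cn_density_ge0.
have Ta : double_integral FS (fun s r => p s r * csq (r - s)) = (PN + e)%:E.
  rewrite /double_integral; under eq_integral => s _.
    rewrite integral_cond_density_csq//.
    under eq_integral => j _.
      under eq_bigr do rewrite addrAC subrr add0r csq_rot.
      rewrite sum_cstM; over.
    rewrite csqD ?(ltW PN0)// eE -EFinD; over.
  by rewrite integral_probability_cst.
have Tb : double_integral FS (fun s r => p s r * csq r) = (PN + PS + e)%:E.
  rewrite /double_integral; under eq_integral => s _.
    under eq_integral => r _ do rewrite -[X in csq X](subr0 r).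
    rewrite integral_cond_density_csq//.
    under eq_integral => j _ do under eq_bigr do rewrite subr0.
    over.
  (* The input is averaged first, for a fixed jammer symbol and phase: its centring removes the
     cross term even if the jammer has a nonzero mean. *)
  rewrite (@fubini_tonelli _ _ (R * R)%type (R * R)%type R FS FJ (fun u =>
    (M%:R^-1 * (\sum_(i < M) (PN + csq (u.1 + Defs.rot M i u.2))))%:E)).
  - under eq_integral => j _.
      rewrite (@integral_average _ _ FS (fun i s => PN + csq (s + Defs.rot M i j))
        (fun=> PN + PS + csq j)).
      2: move=> i; apply: measurable_funD => //; apply/measurable_csq/measurable_funD2.
      2: exact: measurable_id.
      2: exact: measurable_cst.
      2: by move=> i x; rewrite addr_ge0 ?csq_ge0// ltW.
      2: by move=> i; rewrite integral_CN_csqD// csq_rot addrA.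
      rewrite sum_cstM; over.
    by rewrite csqD ?addr_ge0 ?(ltW PN0) ?(ltW PS0)// eE.
  - apply/measurable_EFinP/measurable_funM => //; apply: measurable_sum => i.
    apply: measurable_funD => //; apply: measurable_csq; apply: measurable_funD2.
      exact: measurable_fst.
    by apply: measurable_rot; exact: measurable_snd.
  - move=> u; rewrite lee_fin mulr_ge0 ?invr_ge0 ?(ltW MR0)// sumr_ge0// => i _.
    by rewrite addr_ge0 ?csq_ge0// ltW.
have hVa := ge0_measurable2Z Vi0 ha.
have hWb := ge0_measurable2Z Wi0 hb.
have hcp := ge0_measurable2Z c0 hp.
have : (double_integral FS (fun s r => c * p s r + (W^-1 * (p s r * csq r) + q r))%R <=
  double_integral FS (fun s r => kl_integrand (p s r) (q r) +
    (V^-1 * (p s r * csq (r - s)) + q r * w s r))%R)%E.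
  apply: le_double_integral.
  - by apply: ge0_measurable2D => //; exact: ge0_measurable2D.
  - by apply: ge0_measurable2D => //; exact: ge0_measurable2D.
  (* Nonnegativity of the divergence integrand against [q * w], expanded by [kl_integrandMr], with
     each term on the side where it is nonnegative. *)
  move=> s r; have := kl_integrand_ge0 (p0 s r) (mulr_gt0 (q0 r) (w0 s r)).
  rewrite kl_integrandMr// {1}/w ln_cn_density_ratio// -/c.
  rewrite [_ / W]mulrC [_ / V]mulrC; lra.
rewrite (double_integralD _ hcp (ge0_measurable2D hWb hq)) (double_integralD _ hWb hq).
rewrite (double_integralD _ hk (ge0_measurable2D hVa hqw)) (double_integralD _ hVa hqw).
rewrite (double_integralZ _ Vi0 ha) (double_integralZ _ Wi0 hb) (double_integralZ _ c0 hp).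
rewrite Tp Ta Tb Tq Tqw mule1 -!EFinM -!EFinD => E.
rewrite -(@leeD2rE _ (V^-1 * (PN + e) + 1)%:E)//; apply: le_trans E.
(* What remains is [(PN + e) / V <= (PN + PS + e) / W]; after cross-multiplication the gap is
   [PS * (PJ - e)]. *)
rewrite -EFinD lee_fin lerD2l lerD2r ler_pdivrMl// mulrCA ler_pdivlMl//.
rewrite -subr_ge0 (_ : _ - _ = PS * (PJ - e)); last by ring.
by rewrite mulr_ge0 ?subr_ge0// ltW.
Qed.

Lemma power_le_CN (P : R) (mu : probability (CC R) R) : 0 <= P -> is_CN P mu ->
  power_le P mu.
Proof.
move=> P0 CNmu; rewrite /power_le.
under eq_integral => z _ do rewrite -[X in csq X](subr0 z).
by rewrite (integral_CN_csq _ P0 CNmu) lee_fin /csq/= expr0n/= !addr0.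
Qed.

End saddle.
End channel.

(** * From the two bounds to the saddle point and the max-min value *)

Unset Implicit Arguments.
Unset Strict Implicit.

Theorem theorem3 (R : realType) (b PS PJ PN : R) (M k : nat) :
  1 < b -> 0 < PS -> 0 <= PJ -> 0 < PN -> M = (2 ^ k.+1)%N ->
  let phi := mutual_info b M PN in
  let val := (ln (1 + PS / (PJ + PN)) / ln b)%:E in
  ereal_sup [set ereal_inf [set phi FS FJ | FJ in [set FJ | power_le PJ FJ]]
            | FS in [set FS | power_le PS FS]] = val /\
  (forall FSs FJs : probability (CC R) R,
     is_CN PS FSs -> is_CN PJ FJs ->
     [/\ phi FSs FJs = val,
         ereal_inf [set phi FSs FJ | FJ in [set FJ | power_le PJ FJ]] = val,
         (forall FS, power_le PS FS -> (phi FS FJs <= phi FSs FJs)%E) &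
         (forall FJ, power_le PJ FJ -> (phi FSs FJs <= phi FSs FJ)%E)]).
Proof.
move=> b1 PS0 PJ0 PN0 MK phi val.
have M0 : (0 < M)%N by rewrite MK expn_gt0.
have V0 : 0 < PJ + PN by rewrite ltr_wpDl.
have lb0 : 0 < ln b by rewrite ln_gt0.
have lbi0 : (0 <= ((ln b)^-1)%:E)%E by rewrite lee_fin invr_ge0 ltW.
have valE : val = ((ln ((PS + (PJ + PN)) / (PJ + PN)))%:E * ((ln b)^-1)%:E)%E.
  by rewrite /val -EFinM mulrDl divff ?gt_eqF// [PS / _ + 1]addrC.
have ub FS FJs : power_le PS FS -> is_CN PJ FJs -> (phi FS FJs <= val)%E.
  move=> FSP CNJ; rewrite /phi mutual_infoE// valE lee_wpmul2r//.
  exact: double_integral_kl_CN_ub.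
have lb FSs FJ : is_CN PS FSs -> power_le PJ FJ -> (val <= phi FSs FJ)%E.
  move=> CNS FJP; rewrite /phi mutual_infoE// valE lee_wpmul2r//.
  exact: double_integral_kl_CN_lb.
have PSge0 := ltW PS0.
have eq_val FSs FJs : is_CN PS FSs -> is_CN PJ FJs -> phi FSs FJs = val.
  (* Gaussian laws meet their own power constraints, so both bounds apply to the pair. *)
  move=> CNS CNJ; apply/eqP; rewrite eq_le ub ?lb//; exact: power_le_CN.
have [FJ0 CNJ0] := exists_CN PJ0.
have [FS0 CNS0] := exists_CN PSge0.
have inf_val FSs : is_CN PS FSs ->
    ereal_inf [set phi FSs FJ | FJ in [set FJ | power_le PJ FJ]] = val.
  move=> CNS; apply/eqP; rewrite eq_le; apply/andP; split.
    rewrite -(eq_val _ _ CNS CNJ0); apply: ereal_inf_lbound.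
    by exists FJ0 => //; exact: power_le_CN.
  by apply/ereal_infP => _ [FJ FJP <-]; exact: lb.
split.
  apply/eqP; rewrite eq_le; apply/andP; split.
    (* For any input, the infimum is at most the value against the Gaussian jammer [FJ0], which [ub]
       controls. *)
    apply/ereal_supP => _ [FS FSP <-].
    apply: le_trans (ub _ _ FSP CNJ0); apply: ereal_inf_lbound.
    by exists FJ0 => //; exact: power_le_CN.
  rewrite -(inf_val _ CNS0); apply: ereal_sup_ubound.
  by exists FS0 => //; exact: power_le_CN.
move=> FSs FJs CNS CNJ; split.
- exact: eq_val.
- exact: inf_val.
- by move=> FS FSP; rewrite (eq_val _ _ CNS CNJ); exact: ub.
- by move=> FJ FJP; rewrite (eq_val _ _ CNS CNJ); exact: lb.
Qed.
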